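(* Let $H$ be a Hilbert space, $\mathcal{A}\subseteq B(H)$ a non-degenerate C*-algebra on $H$, $G$ a discrete group and $g\mapsto\alpha_g$ a homomorphism of $G$ into the group of *-automorphisms of $\mathcal{A}$. Let $\mathcal{C}=\mathrm{C}^*_r(\mathcal{A},\alpha,G)\subseteq B(H\otimes\ell_2(G))$, $\Psi$, $L_g$, $\pi$, $K$, $\rho$, $V$, $F$ be as defined in the context. Then the faithful completely positive projection $\pi:\mathcal{C}\to\Psi(\mathcal{A})$ is given by $\pi(X)=V^*\rho(X)V$ for $X\in\mathcal{C}$, and the expression $$X\star Y:=V^*\rho(X)F\rho(Y)V,\qquad X,Y\in\mathcal{C},$$ defines a completely contractive associative product on $\mathcal{C}$ (in particular $X\star Y\in\mathcal{C}$) which satisfies the following statements. (i) For all $X,Y\in\mathcal{C}$: $(X\star Y)^*=Y^*\star X^*$. (ii) For all $X,Y\in\mathcal{C}$ and all $A\in\mathcal{A}$: $(X\star Y)\Psi(A)=X\star(Y\Psi(A))$ and $\Psi(A)(X\star Y)=(\Psi(A)X)\star Y$. (iii) For all $X,Y\in\mathcal{C}$ and all $g\in G$: $\pi\big(L_g^*(X\star Y)\big)=\pi(L_g^*X)\,\pi(L_g^*Y)$. (iv) For all $X,Y\in\mathcal{C}$ and all $\xi,\gamma\in H\otimes\ell_2(G)$: $|\langle (X\star Y)\xi,\gamma\rangle|\le\|\pi(XX^* )^{1/2}\gamma\|\,\|\pi(Y^*Y)^{1/2}\xi\|$. (v) For all $X,Y\in\mathcal{C}$ the sum $\sum_{g\in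 G}L_g\,\pi(L_g^*X)\,\pi(L_g^*Y)$ converges in the norm topology to $X\star Y$. (vi) For all $X,Y\in\mathcal{C}$ there exists a contraction $S(X,Y)$ on $H\otimes\ell_2(G)$ such that $X\star Y=\pi(XX^* )^{1/2}\,S(X,Y)\,\pi(Y^*Y)^{1/2}$. (vii) For all $X\in\mathcal{C}$: $-\pi(X^*X)\le X^*\star X\le\pi(X^*X)$.
   Context: Non-degenerate means that $\mathrm{span}(\mathcal{A}H)$ is dense in $H$. Let $(x_g)_{g\in G}$ be the standard orthonormal basis of $\ell_2(G)$, let $e$ be the unit of $G$, and let $\delta(\cdot,\cdot)$ denote the Kronecker delta. Reduced crossed product. On $H\otimes\ell_2(G)$ define, for $A\in\mathcal{A}$ and $g\in G$, the operators determined by $$\Psi(A)(\xi\otimes x_h)=\alpha_{h}^{-1}(A)\xi\otimes x_h,\qquad L_g(\xi\otimes x_h)=\xi\otimes x_{gh}\qquad(\xi\in H,\ h\in G).$$ That is, $\Psi(A)=\sum_{g\in G}\alpha_g^{-1}(A)\otimes E_g$, where $E_g$ is the rank one projection onto $\mathbb{C}x_g$, and $L_g=I\otimes l_g$, where $l_g$ is left translation. Then $\Psi$ is an injective *-representation of $\mathcal{A}$, $g\mapsto L_g$ is a unitary representation, and $L_g\Psi(A)L_g^*=\Psi(\alpha_g(A))$. The reduced crossed product $\mathcal{C}:=\mathrm{C}^*_r(\mathcal{A},\alpha,G)$ is the C*-algebra on $H\otimes\ell_2(G)$ which is the norm closure of the linear span of $\{L_g\Psi(A): g\in G,\ A\in\mathcal{A}\}$.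 One has $L_g\mathcal{C}\subseteq\mathcal{C}$ for all $g\in G$. It is well known that there is a faithful conditional expectation $\pi$ of $\mathcal{C}$ onto $\Psi(\mathcal{A})$ satisfying $\pi(L_g\Psi(A))=\delta(g,e)\Psi(A)$ for all $g\in G$, $A\in\mathcal{A}$; this determines $\pi$. Stinespring data. Let $K:=\ell_2(G)\otimes H\otimes\ell_2(G)$ and let $\rho:B(H\otimes\ell_2(G))\to B(K)$ be the amplification $\rho(X):=I_{B(\ell_2(G))}\otimes X$. The isometry $V:H\otimes\ell_2(G)\to K$ is given on elementary tensors by $V(\xi\otimes x_g):=x_g\otimes\xi\otimes x_g$. The self-adjoint unitary $F$ on $K$ is given on elementary tensors by $F(x_g\otimes\xi\otimes x_h):=x_h\otimes\xi\otimes x_g$. A bilinear map $\phi:\mathcal{C}\times\mathcal{C}\to\mathcal{C}$ is completely contractive (in the sense of Christensen and Sinclair) if for every $n\in\mathbb{N}$ the map $\phi_n:M_n(\mathcal{C})\times M_n(\mathcal{C})\to M_n(\mathcal{C})$, $\phi_n((X_{ij}),(Y_{ij}))_{ij}=\sum_{k}\phi(X_{ik},Y_{kj})$, satisfies $\|\phi_n(X,Y)\|\le\|X\|\|Y\|$. Sums over $G$ converge in the sense of the net of finite partial sums. *)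

(* Defs.v *)
From HB Require Import structures.
From mathcomp Require Import all_boot all_order all_algebra finmap.
From mathcomp Require Import sesquilinear complex ring.
From mathcomp Require Import boolp classical_sets functions reals topology.
From mathcomp Require Import normedtype summability.

Set Implicit Arguments.
Unset Strict Implicit.
Unset Printing Implicit Defensive.

Import Order.TTheory GRing.Theory Num.Theory numFieldNormedType.Exports.
Local Open Scope ring_scope.
Local Open Scope classical_set_scope.
Local Open Scope complex_scope.

Section dot_norm.
Context (C : numClosedFieldType) (U : lmodType C) (form : {dot U for Num.conj}).

Lemma dot_cauchy_schwarz (u v : U) :
  `|form u v| ^+ 2 <= form u u * form v v.
Proof.
have [->|v0] := eqVneq v 0.
  by rewrite !linear0r normr0 expr0n mulr0.
have vv : 0 < form v v by rewrite dnorm_gt0.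
have := dnorm_ge0 form (form v v *: u - form u v *: v).
rewrite dnormB !dnormZ (ger0_norm (ltW vv)) linearZl_LR linearZr_LR /=.
rewrite !rmorphM /= conjCK (conj_Creal (gtr0_real vv)) normCK => h.
rewrite -subr_ge0 -(pmulr_rge0 _ vv).
by apply: le_trans h _; rewrite le_eqVlt; apply/orP; left; apply/eqP; ring.
Qed.

Definition dot_norm (u : U) : C := sqrtC (form u u).

Lemma dot_normK u : dot_norm u ^+ 2 = form u u.
Proof. exact: sqrtCK. Qed.

Lemma dot_norm_ge0 u : 0 <= dot_norm u.
Proof. by rewrite sqrtC_ge0 dnorm_ge0. Qed.

Lemma dot_norm_cs u v : `|form u v| <= dot_norm u * dot_norm v.
Proof.
rewrite -(@ler_pXn2r _ 2) ?nnegrE ?mulr_ge0 ?dot_norm_ge0//.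
by rewrite exprMn !dot_normK dot_cauchy_schwarz.
Qed.

Lemma dot_normD u v : dot_norm (u + v) <= dot_norm u + dot_norm v.
Proof.
rewrite -(@ler_pXn2r _ 2) ?nnegrE ?addr_ge0 ?dot_norm_ge0//.
rewrite dot_normK dnormD sqrrD !dot_normK [leRHS]addrAC lerD2l.
have -> : form u v + (form u v)^* = 'Re (form u v) *+ 2.
  by rewrite ReE -[X in X = _]divr1 -mulrnAl -mulr_natr mulfK ?pnatr_eq0 ?divr1.
rewrite lerMn2r /=; apply: le_trans (dot_norm_cs u v).
exact: (leif_Re_Creal _).1.
Qed.

Lemma dot_normZ a u : dot_norm (a *: u) = `|a| * dot_norm u.
Proof.
by rewrite /dot_norm dnormZ rootCMl ?exprn_ge0// sqrCK.
Qed.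

Lemma dot_norm_eq0 u : dot_norm u = 0 -> u = 0.
Proof. by move/eqP; rewrite sqrt_dnorm_eq0 => /eqP. Qed.

End dot_norm.

(* The field of complex numbers over [R], as a bundled structure. *)
Definition Cplx (R : realType) : numClosedFieldType :=
  Num.ClosedField.clone R[i] _.

(* [inner] is linear in its first argument and conjugate-linear in its second
   one. *)
HB.mixin Record CompleteNormedModule_isHilbert (C : numClosedFieldType) V
    & CompleteNormedModule C V := {
  inner : {dot V for @Num.conj C};
  sqr_normr_inner : forall x : V, `|x| ^+ 2 = inner x x }.

#[short(type="hilbertType")]
HB.structure Definition Hilbert (C : numClosedFieldType) :=
  {V of CompleteNormedModule C V & CompleteNormedModule_isHilbert C V}.

#[global] Existing Instance totally_filter.

Section nonneg_sums.
Context (R : realType) (I : choiceType).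
Local Notation C := (Cplx R).

Lemma complex_Re_ge0 (z : R[i]) : 0 <= z -> z = (complex.Re z)%:C.
Proof. by case: z => [a b]; rewrite lecE /= => /andP[/eqP -> _]. Qed.

Lemma partial_sum_le (a : I -> C) (J K : {fset I}) :
  (forall i, 0 <= a i) -> (J `<=` K)%fset -> partial_sum a J <= partial_sum a K.
Proof.
move=> a0 JK; rewrite /partial_sum.
rewrite -!(big_seq_fsetE _ _ xpredT a) /=.
rewrite (big_fsetID _ (mem J) K) /=.
have -> : [fset x in K | x \in mem J]%fset = J.
  apply/fsetP => x; rewrite !inE /= andbC; apply: andb_idr; exact: (fsubsetP JK).
by rewrite lerDl sumr_ge0.
Qed.

Lemma nneg_sum_cvg (a : I -> C) (M : C) :
  (forall i, 0 <= a i) -> (forall J, partial_sum a J <= M) ->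
  exists l : C, [/\ partial_sum a @ totally --> l,
    (forall J, partial_sum a J <= l) & l <= M].
Proof.
move=> a0 aM.
have ps0 J : 0 <= partial_sum a J by apply: sumr_ge0.
have psE J := complex_Re_ge0 (ps0 J).
pose S := [set complex.Re (partial_sum a J) | J in setT].
have M0 : 0 <= M := le_trans (ps0 fset0) (aM fset0).
have ubS : ubound S (complex.Re M).
  by move=> _ [J _ <-]; move: (aM J); rewrite lecE => /andP[].
have hS : has_sup S.
  by split; [exists (complex.Re (partial_sum a fset0)); exists fset0 | exists (complex.Re M)].
exists (sup S)%:C; split; last 2 first.
- by move=> J; rewrite psE lecR; apply: ub_le_sup; [exists (complex.Re M) | exists J].
- by rewrite (complex_Re_ge0 M0) lecR; apply: ge_sup => //; exact: hS.1.
apply/cvgrPdist_lt => e e0.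
have eE := complex_Re_ge0 (ltW e0).
have e0' : 0 < complex.Re e by move: e0; rewrite ltcE => /andP[].
have [_ [J0 _ <-] J0e] := sup_adherent e0' hS.
exists J0 => //= J JJ.
have le1 : complex.Re (partial_sum a J0) <= complex.Re (partial_sum a J).
  by rewrite -lecR -!psE partial_sum_le.
have le2 : complex.Re (partial_sum a J) <= sup S.
  by apply: ub_le_sup; [exists (complex.Re M) | exists J].
rewrite psE -rmorphB /= ger0_norm; last by rewrite ler0c subr_ge0.
by rewrite eE ltcR ltrBlDl -ltrBlDr (lt_le_trans J0e).
Qed.

End nonneg_sums.


Lemma sqr_normD_le (C : numClosedFieldType) (H : hilbertType C) (x y : H) :
  `|x + y| ^+ 2 <= 2%:R * `|x| ^+ 2 + 2%:R * `|y| ^+ 2.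
Proof.
rewrite !sqr_normr_inner.
have := dnorm_ge0 inner (x - y); rewrite dnormB dnormD => h; rewrite -subr_ge0.
by apply: le_trans h _; rewrite le_eqVlt; apply/orP; left; apply/eqP; ring.
Qed.

Lemma dot_polarization (C : numClosedFieldType) (U : lmodType C)
  (form : {dot U for Num.conj}) (x y : U) :
  form x y = 4%:R^-1 *
    (form (x + y) (x + y) - form (x - y) (x - y)
    + 'i * form (x + 'i *: y) (x + 'i *: y)
    - 'i * form (x - 'i *: y) (x - 'i *: y)).
Proof.
rewrite !dnormB !dnormD.
have -> : form x ('i *: y) = - 'i * form x y.
  by rewrite linearZr_LR /= conjCi.
rewrite rmorphM rmorphN /= conjCi opprK.
have i2 : 'i * 'i = -1 :> C by rewrite -expr2 sqrCi.
have n4 : 4%:R != 0 :> C by rewrite pnatr_eq0.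
set a := form x y; set b := a^*%R.
set c := form x x; set d := form y y; set e := form _ _.
apply: (mulfI n4); rewrite mulVKf//.
transitivity (a *+ 4); first by rewrite mulr_natl.
transitivity ((a + b) *+ 2 - 'i * 'i * (a - b) *+ 2); last by ring.
by rewrite i2; ring.
Qed.

Lemma cvg_polarization (C : numFieldType) (T : Type) (F : set_system T)
    (FF : Filter F) (f1 f2 f3 f4 : T -> C) (z1 z2 z3 z4 k c : C) :
  f1 @ F --> z1 -> f2 @ F --> z2 -> f3 @ F --> z3 -> f4 @ F --> z4 ->
  (fun x => k * (f1 x - f2 x + c * f3 x - c * f4 x)) @ F -->
  k * (z1 - z2 + c * z3 - c * z4).
Proof.
move=> c1 c2 c3 c4; apply: cvgMr; apply: cvgB; last exact: cvgMr.
by apply: cvgD; [exact: cvgB|exact: cvgMr].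
Qed.

Lemma cvg_sum_seq (C : numFieldType) (T K : Type) (F : set_system T)
    (FF : Filter F) (r : seq K) (f : K -> T -> C) (l : K -> C) :
  (forall k, f k @ F --> l k) ->
  (fun x => \sum_(k <- r) f k x) @ F --> \sum_(k <- r) l k.
Proof.
move=> fl; elim: r => [|k r IH].
  by under eq_fun do rewrite big_nil; rewrite big_nil; exact: cvg_cst.
by under eq_fun do rewrite big_cons; rewrite big_cons; apply: cvgD.
Qed.

Section l2_space.
Context (R : realType) (I : choiceType) (H : hilbertType (Cplx R)).
Local Notation C := (Cplx R).
Implicit Types f g : I -> H.

Definition sqr_summable : {pred I -> H} := fun f =>
  `[< exists M : C, forall J, partial_sum (fun i => `|f i| ^+ 2) J <= M >].

Lemma sqr_summable_submod_closed : submod_closed sqr_summable.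
Proof.
split.
  apply/asboolP; exists 0 => J.
  by apply: sumr_le0 => i _; rewrite normr0 expr0n.
move=> a f g /asboolP[M fM] /asboolP[N gN]; apply/asboolP.
exists (2%:R * (`|a| ^+ 2 * M) + 2%:R * N) => J.
apply: (@le_trans _ _ (2%:R * (`|a| ^+ 2 * partial_sum (fun i => `|f i| ^+ 2) J)
  + 2%:R * partial_sum (fun i => `|g i| ^+ 2) J)).
  rewrite /partial_sum !mulr_sumr -big_split /=; apply: ler_sum => i _.
  apply: le_trans (sqr_normD_le (a *: f (val i)) (g (val i))) _.
  by rewrite normrZ exprMn.
apply: lerD; last by apply: ler_wpM2l (gN J).
by apply: ler_wpM2l => //; apply: ler_wpM2l (fM J); rewrite exprn_ge0.
Qed.

HB.instance Definition _ := GRing.isSubmodClosed.Build C (I -> H) sqr_summable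
  sqr_summable_submod_closed.

Record l2_vec := L2Vec { l2_fun :> I -> H; l2_funP : l2_fun \in sqr_summable }.

HB.instance Definition _ := [isSub for l2_fun].
HB.instance Definition _ := [Choice of l2_vec by <:].
HB.instance Definition _ := [SubChoice_isSubLmodule of l2_vec by <:].

Implicit Types u v w : l2_vec.

Lemma l2P u v : (forall i, u i = v i) -> u = v.
Proof. by move=> uv; apply/val_inj/funext. Qed.

Definition l2_inner u v : C := sum (fun i => inner (u i) (v i)).

Lemma l2_sqr_cvg u : exists l : C,
  [/\ partial_sum (fun i => `|u i| ^+ 2) @ totally --> l &
   forall J, partial_sum (fun i => `|u i| ^+ 2) J <= l].
Proof.
have /asboolP[M uM] := l2_funP u.
have u0 i : 0 <= `|u i| ^+ 2 by rewrite exprn_ge0.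
by have [l [? ? _]] := nneg_sum_cvg u0 uM; exists l.
Qed.

Lemma l2_inner_cvg u v :
  partial_sum (fun i => inner (u i) (v i)) @ totally --> l2_inner u v.
Proof.
have [z1 [c1 _]] := l2_sqr_cvg (u + v).
have [z2 [c2 _]] := l2_sqr_cvg (u - v).
have [z3 [c3 _]] := l2_sqr_cvg (u + 'i *: v).
have [z4 [c4 _]] := l2_sqr_cvg (u - 'i *: v).
have h := @cvg_polarization C _ _ _ _ _ _ _ _ _ _ _ 4%:R^-1 'i c1 c2 c3 c4.
suff E : (fun J => partial_sum (fun i => inner (u i) (v i)) J) = (fun J => 4%:R^-1 * (
   partial_sum (fun i => `|(u + v) i| ^+ 2) J
  - partial_sum (fun i => `|(u - v) i| ^+ 2) J
  + 'i * partial_sum (fun i => `|(u + 'i *: v) i| ^+ 2) J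
  - 'i * partial_sum (fun i => `|(u - 'i *: v) i| ^+ 2) J)).
  by move: h; rewrite -E => h; apply/cvg_ex; eexists; exact: h.
apply/funext => J; rewrite /partial_sum.
rewrite !mulr_sumr -!sumrN -!big_split /= mulr_sumr.
by apply: eq_bigr => i _; rewrite (dot_polarization inner) -!sqr_normr_inner.
Qed.

Lemma sum_unique (a : I -> C) (l : C) : partial_sum a @ totally --> l -> sum a = l.
Proof. by move=> al; apply: (cvg_lim _ al); exact: norm_hausdorff. Qed.

Lemma l2_inner_linearl w : linear_for *%R (l2_inner ^~ w).
Proof.
move=> a u v; apply: sum_unique.
have -> : partial_sum (fun i => inner ((a *: u + v) i) (w i)) =
  (fun J => a * partial_sum (fun i => inner (u i) (w i)) J
            + partial_sum (fun i => inner (v i) (w i)) J).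
  apply/funext => J; rewrite /partial_sum mulr_sumr -big_split /=.
  by apply: eq_bigr => i _; rewrite linearDl linearZl_LR.
by apply: cvgD; [apply: cvgMr|]; exact: l2_inner_cvg.
Qed.

Lemma l2_inner_hermitian u v : l2_inner u v = (-1) ^+ false * (l2_inner v u)^*.
Proof.
rewrite expr0 mul1r; apply: sum_unique.
have -> : partial_sum (fun i => inner (u i) (v i)) =
  (fun J => (partial_sum (fun i => inner (v i) (u i)) J)^*).
  apply/funext => J; rewrite /partial_sum raddf_sum /=.
  by apply: eq_bigr => i _; rewrite hermC /= expr0 mul1r.
have h := @l2_inner_cvg v u.
apply/cvgrPdist_lt => e e0; move/cvgrPdist_lt: h => /(_ _ e0).
by apply: filterS => J; rewrite -rmorphB /= norm_conjC.
Qed.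

Lemma l2_inner_linearr u : linear_for (@Num.conj C \; *%R) (l2_inner u).
Proof.
move=> a v w; rewrite !(l2_inner_hermitian u) expr0 !mul1r l2_inner_linearl.
by rewrite rmorphD rmorphM.
Qed.

Lemma l2_inner_bilinear :
  bilinear_for *%R (@Num.conj C \; *%R) l2_inner.
Proof. by split; [exact: l2_inner_linearl|exact: l2_inner_linearr]. Qed.

Lemma l2_inner_ge u i : `|u i| ^+ 2 <= l2_inner u u.
Proof.
have [l [ul le_l]] := l2_sqr_cvg u.
have -> : l2_inner u u = l.
  apply: sum_unique; move: ul.
  by under eq_fun do rewrite sqr_normr_inner.
apply: le_trans (le_l [fset i]%fset); rewrite /partial_sum.
by rewrite -(big_seq_fsetE _ _ xpredT (fun i => `|u i| ^+ 2)) big_seq_fset1.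
Qed.

Lemma l2_inner_gt0 u : u != 0 -> 0 < l2_inner u u.
Proof.
move=> u0; have [i ui0] : exists i, u i != 0.
  apply: contrapT => /forallNP h; move/negP: u0; apply; apply/eqP/l2P => i.
  by apply/eqP; move/negP: (h i); rewrite negbK.
by apply: lt_le_trans (l2_inner_ge u i); rewrite exprn_gt0// normr_gt0.
Qed.

HB.instance Definition _ := bilinear_isBilinear.Build C l2_vec l2_vec C *%R
  (@Num.conj C \; *%R) l2_inner l2_inner_bilinear.
HB.instance Definition _ :=
  isHermitianSesquilinear.Build C l2_vec false (@Num.conj C) l2_inner l2_inner_hermitian.
HB.instance Definition _ := isDotProduct.Build C l2_vec l2_inner l2_inner_gt0.

Definition l2_dot : {dot l2_vec for @Num.conj C} := l2_inner.

HB.instance Definition _ := Lmodule_isNormed.Build C l2_vec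
  (dot_normD l2_dot) (dot_normZ l2_dot) (@dot_norm_eq0 _ _ l2_dot).

Lemma l2_sqr_norm u : `|u| ^+ 2 = l2_dot u u.
Proof. exact: dot_normK. Qed.

Lemma l2_norm_le u (M : C) : 0 <= M ->
  (forall J, partial_sum (fun i => `|u i| ^+ 2) J <= M ^+ 2) -> `|u| <= M.
Proof.
move=> M0 uM; rewrite -(@ler_pXn2r _ 2) ?nnegrE// l2_sqr_norm.
have u0 i : 0 <= `|u i| ^+ 2 by rewrite exprn_ge0.
have [l [ul _ lM]] := nneg_sum_cvg u0 uM.
suff -> : l2_dot u u = l by [].
by apply: sum_unique; move: ul; under eq_fun do rewrite sqr_normr_inner.
Qed.

Lemma l2_coord_le u i : `|u i| <= `|u|.
Proof. by rewrite -(@ler_pXn2r _ 2) ?nnegrE// l2_sqr_norm l2_inner_ge. Qed.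

Lemma l2_cauchy_cvg (F : set_system l2_vec) : ProperFilter F -> cauchy F -> cvg F.
Proof.
move=> FF /cauchy_ballP Fc.
have FA (e : C) : 0 < e ->
    exists A : set l2_vec, F A /\ forall u v, A u -> A v -> `|u - v| < e.
  move=> e0; have [[A B] /= [FA FB] AB] := Fc _ e0.
  exists (A `&` B); split; first exact: filterI.
  move=> u v [Au _] [_ Bv]; have := AB (u, v) (conj Au Bv).
  by rewrite -ball_normE.
have Fi i : cvg ((fun u : l2_vec => u i) @ F).
  apply: cauchy_cvg; apply/cauchy_ballP => e e0.
  have [A [A1 A2]] := FA _ e0.
  exists ((fun u : l2_vec => u i) @` A, (fun u : l2_vec => u i) @` A).
    have h : F ((fun u : l2_vec => u i) @^-1` ((fun u : l2_vec => u i) @` A)).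
      by apply: filterS A1 => u Au; exists u.
    by split; exact: h.
  move=> [_ _] /= [[u Au <-] [v Av <-]]; rewrite -ball_normE /=.
  exact: le_lt_trans (l2_coord_le (u - v) i) (A2 _ _ Au Av).
pose f i : H := lim ((fun u : l2_vec => u i) @ F).
have key (e : C) : 0 < e -> exists2 A : set l2_vec, F A & forall u, A u ->
    forall J, partial_sum (fun i => `|u i - f i| ^+ 2) J <= (2%:R * e) ^+ 2.
  move=> e0; have [A [A1 A2]] := FA _ e0; exists A => // u Au J.
  have h : (fun v : l2_vec => partial_sum (fun i => `|v i - f i| ^+ 2) J) @ F -->
      (0 : C).
    have -> : (0 : C) = \sum_(i : J) 0 by rewrite big1.
    apply: cvg_sum_seq => i.
    have -> : (0 : C) = `|0 : H| ^+ 2 by rewrite normr0 expr0n.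
    have c : (fun v : l2_vec => v (val i) - f (val i)) @ F --> (0 : H).
      by rewrite -(subrr (f (val i))); apply: cvgB; [exact: Fi|exact: cvg_cst].
    exact: cvgM (cvg_norm c) (cvg_norm c).
  have e2 : 0 < e ^+ 2 by rewrite exprn_gt0.
  move/cvgrPdist_lt: h => /(_ _ e2) h.
  have [v [Av]] := filter_ex (filterI A1 h).
  have ps0 (a : I -> H) : 0 <= partial_sum (fun i => `|a i| ^+ 2) J.
    by apply: sumr_ge0 => i _; rewrite exprn_ge0.
  rewrite /= sub0r normrN ger0_norm; last exact: (ps0 (fun i => v i - f i)).
  move=> hv.
  apply: (@le_trans _ _ (2%:R * partial_sum (fun i => `|(u - v) i| ^+ 2) J
      + 2%:R * partial_sum (fun i => `|v i - f i| ^+ 2) J)).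
    rewrite /partial_sum !mulr_sumr -big_split /=; apply: ler_sum => i _.
    have -> : u (val i) - f (val i)
        = (u (val i) - v (val i)) + (v (val i) - f (val i)).
      by rewrite addrA subrK.
    exact: sqr_normD_le.
  have huv : partial_sum (fun i => `|(u - v) i| ^+ 2) J <= e ^+ 2.
    have [l [ul le_l]] := l2_sqr_cvg (u - v).
    apply: le_trans (le_l J) _.
    have <- : l2_dot (u - v) (u - v) = l.
      by apply: sum_unique; move: ul; under eq_fun do rewrite sqr_normr_inner.
    rewrite -l2_sqr_norm ler_pXn2r ?nnegrE//; last exact: ltW.
    by apply/ltW/A2.
  have -> : (2%:R * e) ^+ 2 = 2%:R * e ^+ 2 + 2%:R * e ^+ 2 by ring.
  by apply: lerD; apply: ler_wpM2l => //; exact: ltW.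
have [A0 FA0 A0f] := key 1 ltr01.
have [u0 A0u0] := filter_ex FA0.
have d_l2 u e : (forall J, partial_sum (fun i => `|u i - f i| ^+ 2) J <= e) ->
    (fun i => u i - f i) \in sqr_summable.
  by move=> h; apply/asboolP; exists e.
have f_l2 : f \in sqr_summable.
  have -> : f = (u0 : I -> H) - (fun i => u0 i - f i).
    by apply/funext => i; rewrite !fctE opprB addrC subrK.
  by apply: rpredB; [exact: l2_funP|exact: d_l2 (A0f _ A0u0)].
apply/cvg_ex; exists (L2Vec f_l2); apply/cvgrPdist_le => e e0.
have e20 : 0 < e / 2%:R by rewrite divr_gt0.
have [A F_A Af] := key _ e20.
apply: filterS F_A => u Au; rewrite distrC.
apply: l2_norm_le; first exact: ltW.
by move=> J; have := Af u Au J; rewrite mulrC divfK ?pnatr_eq0.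
Qed.

HB.instance Definition _ := Uniform_isComplete.Build l2_vec l2_cauchy_cvg.
HB.instance Definition _ :=
  CompleteNormedModule_isHilbert.Build C l2_vec l2_sqr_norm.

Definition l2 : hilbertType C := Hilbert.clone C l2_vec _.

End l2_space.

Section bounded_operators.
Context (R : realType).
Local Notation C := (Cplx R).

Section bop.
Context (U V : hilbertType C).

Definition bounded_linear : {pred U -> V} := fun T =>
  `[< linear T /\ exists M : C, forall x, `|T x| <= M * `|x| >].

Lemma bounded_linear_submod_closed : submod_closed bounded_linear.
Proof.
split.
  apply/asboolP; split; first by move=> a x y /=; rewrite scaler0 addr0.
  by exists 0 => x; rewrite mul0r normr0.
move=> a S T /asboolP[Sl [M SM]] /asboolP[Tl [N TN]]; apply/asboolP; split.
  move=> b x y; rewrite -[LHS]/(a *: S (b *: x + y) + T (b *: x + y)).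
  rewrite -[RHS]/(b *: (a *: S x + T x) + (a *: S y + T y)).
  by rewrite Sl Tl !scalerDr !scalerA mulrC addrACA.
exists (`|a| * M + N) => x; rewrite -[X in `|X| <= _]/(a *: S x + T x).
apply: le_trans (ler_normD _ _) _; rewrite mulrDl normrZ -mulrA.
by apply: lerD; [apply: ler_wpM2l|].
Qed.

HB.instance Definition _ := GRing.isSubmodClosed.Build C (U -> V) bounded_linear
  bounded_linear_submod_closed.

Record bop := Bop { bop_fun :> U -> V; bop_funP : bop_fun \in bounded_linear }.

HB.instance Definition _ := [isSub for bop_fun].
HB.instance Definition _ := [Choice of bop by <:].
HB.instance Definition _ := [SubChoice_isSubLmodule of bop by <:].

Implicit Types S T : bop.

Lemma bop_linear T : linear T.
Proof. by have /asboolP[] := bop_funP T. Qed.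

Lemma bopZ T a x : T (a *: x) = a *: T x.
Proof. exact: (scalable_linear (@bop_linear T)). Qed.

(* The norm of a module over [C] takes its values in [C], hence the real part
   and the embedding of the supremum into [C]. *)
Definition opnorm T : C :=
  (sup [set complex.Re `|T x| | x in [set x | `|x| <= 1]])%:C.

Lemma has_sup_opnorm T :
  has_sup [set complex.Re `|T x| | x in [set x | `|x| <= 1]].
Proof.
have /asboolP[_ [M TM]] := bop_funP T.
split; first by exists (complex.Re `|T 0|); exists 0 => //=; rewrite normr0.
exists (complex.Re `|M|) => _ [x /= x1 <-].
suff : `|T x| <= `|M| by rewrite lecE => /andP[].
have M0 : 0 <= M * `|x| := le_trans (normr_ge0 _) (TM x).
apply: le_trans (TM x) _; rewrite -(ger0_norm M0) normrM normr_id.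
by rewrite -[leRHS]mulr1 ler_wpM2l.
Qed.

Lemma opnorm_ub T x : `|x| <= 1 -> `|T x| <= opnorm T.
Proof.
move=> x1; rewrite [leLHS](complex_Re_ge0 (normr_ge0 (T x))) lecR.
by apply: ub_le_sup; [exact: (has_sup_opnorm T).2|exists x].
Qed.

Lemma opnorm_ge0 T : 0 <= opnorm T.
Proof. by apply: le_trans (opnorm_ub T (x := 0) _) => //; rewrite normr0. Qed.

Lemma opnorm_le T (M : C) : 0 <= M ->
  (forall x, `|x| <= 1 -> `|T x| <= M) -> opnorm T <= M.
Proof.
move=> M0 TM; rewrite (complex_Re_ge0 M0) lecR.
apply: ge_sup; first exact: (has_sup_opnorm T).1.
by move=> _ [x /= x1 <-]; have := TM x x1; rewrite lecE => /andP[].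
Qed.

Lemma bop_le T x : `|T x| <= opnorm T * `|x|.
Proof.
have [->|x0] := eqVneq x 0.
  have -> : T 0 = 0 by rewrite -[X in T X](scale0r (0 : U)) bopZ scale0r.
  by rewrite !normr0 mulr0.
have nx : 0 < `|x| by rewrite normr_gt0.
have := @opnorm_ub T (`|x|^-1 *: x).
rewrite bopZ !normrZ normrV ?unitfE ?gt_eqF// normr_id mulVf ?gt_eqF//.
by move=> /(_ (lexx _)); rewrite mulrC ler_pdivrMr.
Qed.

Lemma opnormD S T : opnorm (S + T) <= opnorm S + opnorm T.
Proof.
apply: opnorm_le; first by rewrite addr_ge0 ?opnorm_ge0.
move=> x x1; rewrite -[X in `|X| <= _]/(S x + T x).
by apply: le_trans (ler_normD _ _) _; rewrite lerD// opnorm_ub.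
Qed.

Lemma opnormZ a T : opnorm (a *: T) = `|a| * opnorm T.
Proof.
have le_ b S : opnorm (b *: S) <= `|b| * opnorm S.
  apply: opnorm_le; first by rewrite mulr_ge0 ?opnorm_ge0.
  move=> x x1; rewrite -[X in `|X| <= _]/(b *: S x) normrZ.
  by rewrite ler_wpM2l// opnorm_ub.
apply/eqP; rewrite eq_le le_ /=.
have [->|a0] := eqVneq a 0; first by rewrite normr0 mul0r opnorm_ge0.
rewrite -ler_pdivlMl ?normr_gt0// -normfV.
by have := le_ a^-1 (a *: T); rewrite scalerA mulVf// scale1r.
Qed.

Lemma opnorm_eq0 T : opnorm T = 0 -> T = 0.
Proof.
move=> T0; apply/val_inj/funext => x; apply/eqP; rewrite -normr_le0.
by have := bop_le T x; rewrite T0 mul0r.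
Qed.

HB.instance Definition _ :=
  Lmodule_isNormed.Build C bop opnormD opnormZ opnorm_eq0.

End bop.

Lemma bcomp_subproof (U V W : hilbertType C) (S : bop V W) (T : bop U V) :
  (S \o T) \in @bounded_linear U W.
Proof.
apply/asboolP; split; first by move=> a x y /=; rewrite !bop_linear.
exists (opnorm S * opnorm T) => x /=; apply: le_trans (bop_le S _) _.
by rewrite -mulrA ler_wpM2l ?opnorm_ge0 ?bop_le.
Qed.

Definition bcomp (U V W : hilbertType C) (S : bop V W) (T : bop U V) : bop U W :=
  Bop (bcomp_subproof S T).

End bounded_operators.

Notation "S *o T" := (bcomp S T) (at level 40, left associativity) : ring_scope.

Section operator_theory.
Context (R : realType).
Local Notation C := (Cplx R).

(* The Hilbert space adjoint: it exists and is unique by the Riesz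
   representation theorem. *)
Definition adj (U V : hilbertType C) (T : bop U V) : bop V U :=
  xget 0 [set S : bop V U | forall x y, inner (T x) y = inner x (S y)].

Definition op_ge0 (U : hilbertType C) (T : bop U U) : Prop :=
  forall x, 0 <= inner (T x) x.

Definition op_le (U : hilbertType C) (S T : bop U U) : Prop := op_ge0 (T - S).

(* The positive square root of a positive operator, which exists and is
   unique. *)
Definition op_sqrt (U : hilbertType C) (T : bop U U) : bop U U :=
  xget 0 [set S : bop U U | op_ge0 S /\ S *o S = T].

Definition linear_span (W : lmodType C) (S : set W) : set W :=
  [set w | exists n (c : 'I_n -> C) (v : 'I_n -> W),
     (forall i, S (v i)) /\ w = \sum_i c i *: v i].

Record is_cstar_algebra (U : hilbertType C) (A : set (bop U U)) : Prop := {
  cstar0 : A 0;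
  cstarD : forall S T, A S -> A T -> A (S + T);
  cstarZ : forall (a : C) T, A T -> A (a *: T);
  cstarM : forall S T, A S -> A T -> A (S *o T);
  cstar_adj : forall T, A T -> A (adj T);
  cstar_closed : closed A }.

Definition is_nondegenerate (U : hilbertType C) (A : set (bop U U)) : Prop :=
  dense (linear_span [set y : U | exists2 T, A T & exists x, y = T x]).

Record is_star_automorphism (U : hilbertType C) (A : set (bop U U))
    (f : bop U U -> bop U U) : Prop := {
  automorphism_bij : set_bij A A f;
  automorphismD : forall S T, A S -> A T -> f (S + T) = f S + f T;
  automorphismZ : forall (a : C) T, A T -> f (a *: T) = a *: f T;
  automorphismM : forall S T, A S -> A T -> f (S *o T) = f S *o f T;
  automorphism_adj : forall T, A T -> f (adj T) = adj (f T) }.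

(* Only the values of [alpha g] on [A] matter. *)
Record is_action (U : hilbertType C) (G : groupType) (A : set (bop U U))
    (alpha : G -> bop U U -> bop U U) : Prop := {
  action_automorphism : forall g, is_star_automorphism A (alpha g);
  actionM : forall g h T, A T -> alpha (g * h)%g T = alpha g (alpha h T) }.

Lemma single_subproof (I : choiceType) (U : hilbertType C) (i : I) (x : U) :
  (fun j => if j == i then x else 0) \in @sqr_summable R I U.
Proof.
apply/asboolP; exists (`|x| ^+ 2) => J; rewrite /partial_sum.
rewrite -(big_seq_fsetE _ _ xpredT (fun j => `|if j == i then x else 0| ^+ 2)) /=.
have [iJ|iJ] := boolP (i \in J).
  rewrite (big_fsetD1 i) //= eqxx big_seq_cond big1 ?addr0// => j.
  by rewrite !inE => /andP[/andP[/negPf -> _] _]; rewrite normr0 expr0n.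
rewrite big_seq_cond big1 ?exprn_ge0// => j /andP[jJ _].
by case: eqP => [ji|_]; [rewrite ji (negPf iJ) in jJ|rewrite normr0 expr0n].
Qed.

(* [l2 I U] is the Hilbert space tensor product of l_2(I) and [U]; [single i x]
   is the elementary tensor of the basis vector at [i] and of [x]. *)
Definition single (I : choiceType) (U : hilbertType C) (i : I) (x : U) : l2 I U :=
  L2Vec (single_subproof i x).

(* The operator on U^n with operator matrix [X]: it identifies the n x n
   matrices over B(U) with B(U^n). *)
Definition mxop (U : hilbertType C) n (X : 'M[bop U U]_n) :
    bop (l2 'I_n U) (l2 'I_n U) :=
  xget 0 [set T : bop (l2 'I_n U) (l2 'I_n U) |
    forall j x, T (single j x) = \sum_i single i (X i j x)].

Definition entries_in (U : Type) n (D : set U) (X : 'M[U]_n) : Prop :=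
  forall i j, D (X i j).

Definition completely_positive (U : hilbertType C) (D : set (bop U U))
    (E : bop U U -> bop U U) : Prop :=
  forall n (X : 'M[bop U U]_n), entries_in D X ->
    op_ge0 (mxop X) -> op_ge0 (mxop (map_mx E X)).

(* A map between operator algebras is given by a function on all operators, of
   which only the values on the domain [D] matter. *)
Record is_conditional_expectation (U : hilbertType C) (D B : set (bop U U))
    (E : bop U U -> bop U U) : Prop := {
  cond_exp_range : forall X, D X -> B (E X);
  cond_exp_id : forall X, B X -> E X = X;
  cond_exp_linear : forall (a : C) X Y, D X -> D Y ->
    E (a *: X + Y) = a *: E X + E Y;
  cond_exp_contractive : forall X, D X -> `|E X| <= `|X|;
  cond_exp_cp : completely_positive D E;
  cond_exp_bimodule : forall S X T, B S -> D X -> B T ->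
    E (S *o X *o T) = S *o E X *o T }.

Definition faithful_on (U : hilbertType C) (D : set (bop U U))
    (E : bop U U -> bop U U) : Prop :=
  forall X, D X -> E (adj X *o X) = 0 -> X = 0.

Definition amplification_mx (U : hilbertType C) n
    (phi : bop U U -> bop U U -> bop U U) (X Y : 'M[bop U U]_n) :
    'M[bop U U]_n :=
  \matrix_(i, j) \sum_k phi (X i k) (Y k j).

Record is_cc_assoc_product (U : hilbertType C) (D : set (bop U U))
    (phi : bop U U -> bop U U -> bop U U) : Prop := {
  product_closed : forall X Y, D X -> D Y -> D (phi X Y);
  product_linearl : forall (a : C) X Y Z, D X -> D Y -> D Z ->
    phi (a *: X + Y) Z = a *: phi X Z + phi Y Z;
  product_linearr : forall (a : C) X Y Z, D X -> D Y -> D Z ->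
    phi X (a *: Y + Z) = a *: phi X Y + phi X Z;
  productA : forall X Y Z, D X -> D Y -> D Z ->
    phi (phi X Y) Z = phi X (phi Y Z);
  product_cc : forall n (X Y : 'M[bop U U]_n), entries_in D X -> entries_in D Y ->
    `|mxop (amplification_mx phi X Y)| <= `|mxop X| * `|mxop Y| }.

End operator_theory.

(* H (x) l_2(G) is [l2 G H], with xi (x) x_h rendered as [single h xi], and
   K = l_2(G) (x) H (x) l_2(G) is [l2 G (l2 G H)], with x_g (x) xi (x) x_h
   rendered as [single g (single h xi)].  Each operator below is the bounded
   operator prescribed by its values on elementary tensors. *)
Section crossed_product.
Context (R : realType) (H : hilbertType (Cplx R)) (G : groupType).
Local Notation HG := (l2 G H).
Local Notation K := (l2 G HG).

Definition Lop (g : G) : bop HG HG :=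
  xget 0 [set T : bop HG HG |
    forall xi h, T (single h xi) = single (g * h)%g xi].

Definition rho (X : bop HG HG) : bop K K :=
  xget 0 [set T : bop K K | forall g eta, T (single g eta) = single g (X eta)].

Definition Vop : bop HG K :=
  xget 0 [set T : bop HG K |
    forall xi g, T (single g xi) = single g (single g xi)].

Definition Fop : bop K K :=
  xget 0 [set T : bop K K |
    forall g xi h, T (single g (single h xi)) = single h (single g xi)].

Definition star (X Y : bop HG HG) : bop HG HG :=
  adj Vop *o rho X *o Fop *o rho Y *o Vop.

Context (A : set (bop H H)) (alpha : G -> bop H H -> bop H H).

(* Since alpha is a homomorphism, the inverse of [alpha h] is [alpha h^-1]. *)
Definition Psi (a : bop H H) : bop HG HG :=
  xget 0 [set T : bop HG HG |
    forall xi h, T (single h xi) = single h (alpha h^-1%g a xi)].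

Definition crossed_product : set (bop HG HG) :=
  closure (linear_span [set X | exists g, exists2 a, A a & X = Lop g *o Psi a]).

Definition is_canonical_expectation (E : bop HG HG -> bop HG HG) : Prop :=
  [/\ is_conditional_expectation crossed_product (Psi @` A) E,
      faithful_on crossed_product E &
      forall g a, A a -> E (Lop g *o Psi a) = (g == 1%g)%:R *: Psi a].

(* Such an expectation exists, and its values on [crossed_product] are
   uniquely determined. *)
Definition canonical_expectation : bop HG HG -> bop HG HG :=
  xget (fun=> 0) [set E | is_canonical_expectation E].

End crossed_product.
Arguments Lop {R H G} g.
Arguments Vop {R H G}.
Arguments Fop {R H G}.
Arguments star {R H G} X Y.

(* Main.v *)
Require Import Defs.
From HB Require Import structures.
From mathcomp Require Import all_boot all_order all_algebra finmap.
From mathcomp Require Import sesquilinear complex ring.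
From mathcomp Require Import boolp classical_sets functions reals topology.
From mathcomp Require Import normedtype summability.

Set Implicit Arguments.
Unset Strict Implicit.
Unset Printing Implicit Defensive.

Import Order.TTheory GRing.Theory Num.Theory numFieldNormedType.Exports.
Local Open Scope ring_scope.
Local Open Scope classical_set_scope.

(** An operator X on H (x) l_2(G) is determined by its entries X_gh in B(H),
    where X_gh xi is the coordinate at g of X (xi (x) x_h). In these terms V^*
    rho(X) V keeps the diagonal entries X_gg and drops the others
    ([entry_diag_part]), and V^* rho(X) F rho(Y) V is the blockwise Schur
    product, with entries X_gh Y_gh ([entry_star]). Since V is an isometry and
    F a self-adjoint unitary, the formulas with V, rho and F give every norm
    estimate, while the entries give every algebraic identity: associativity,
    the rule for adjoints, the module properties over Psi(A), whose elements
    are block diagonal, and the rule pi(L_g^* (X * Y)) = pi(L_g^* X) pi(L_g^*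
    Y), are all read off entry by entry, for arbitrary operators.

    The crossed product D enters in three places. The diagonal part of L_g
    Psi(a) is Psi(a) or 0, and Psi(A) is norm closed because Psi is isometric,
    so the diagonal part maps D onto Psi(A); this makes it a faithful
    conditional expectation of D, and an expectation with the same values on
    the generators equals it by continuity. The product maps D x D to D because
    (L_g Psi(a)) * Y = L_g Psi(a) pi(L_g^* Y) for a generator. And the sum of
    the L_g pi(L_g^* X) pi(L_g^* Y) converges to X * Y in norm: its partial sum
    over a finite set J is the product with all entries outside {(g, h) | g
    h^-1 in J} removed, and this truncated product is still bounded by |X| |Y|
    ([normb_cut_star]), so convergence has to be checked only when X is a
    generator, where the partial sums are eventually constant.

    For the remaining statements put T_Y = rho(Y) V. Then T_Y^* T_Y is pi(Y^*
    Y), so that |T_Y xi| = |pi(Y^* Y)^(1/2) xi|, and X * Y is T_Z^* F T_Y for Z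
    = X^*. The Cauchy-Schwarz inequality then gives the bound on its matrix
    coefficients, Douglas factorization of T_Y and T_Z through the square roots
    gives the contraction S, and the two-sided bound on X^* * X holds because
    the self-adjoint unitary F lies between -1 and 1. Complete contractivity is
    the estimate for n x n operator matrices, for which l_2(G, H)^n and l_2(G,
    H^n) are exchanged by the swap that also defines F ([mxop_star]).

    Three facts of operator theory are needed. The Riesz theorem is proved in a
    form relative to the range of an operator ([riesz_range]), which gives both
    adjoints and Douglas factorization. For |T| <= 1 the equation T + c^2 = 2 c
    has a solution that is a norm limit of polynomials in T ([quadratic_root]);
    as 1 - c is then a square root of 1 - T, this gives square roots of
    positive operators. It also shows that a star automorphism of a C*-algebra
    is contractive ([automorphism_contractive]), without which Psi(a) would not
    be known to be bounded. *)

(** * Bounded operators between Hilbert spaces *)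

Section hilbert_space.
Context (R : realType).
Local Notation C := (Cplx R).
Implicit Types U V W : hilbertType C.

(** The constant [k] lets the error terms of a limit argument be added up
    without rescaling [e] beforehand. *)
Lemma le_of_le_eps (x y k : C) : 0 <= k ->
  (forall e, 0 < e -> x <= y + k * e) -> x <= y.
Proof.
move=> k0 h; apply/ler_addgt0Pr => e e0.
have k1 : 0 < k + 1 by rewrite ltr_wpDl.
apply: le_trans (h (e / (k + 1)) _) _; first by rewrite divr_gt0.
rewrite lerD2l mulrA ler_pdivrMr// mulrC ler_wpM2l// ?lerDl//.
exact: ltW.
Qed.

Lemma norm_le_eps_eq0 (x k : C) : 0 <= k -> (forall e, 0 < e -> `|x| <= k * e) -> x = 0.
Proof.
move=> k0 h; apply/eqP; rewrite -normr_le0; apply: (@le_of_le_eps _ _ k) => // e e0.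
by rewrite add0r h.
Qed.

Lemma invn_lt_eps (e : C) : 0 < e ->
  exists N, forall n, (N <= n)%N -> (n.+1%:R)^-1 < e.
Proof.
move=> e0; have eE := complex_Re_ge0 (ltW e0).
have r0 : 0 < complex.Re e by move: e0; rewrite ltcE => /andP[].
exists (Num.trunc (complex.Re e)^-1) => n Nn; rewrite eE.
have -> : (n.+1%:R : C)^-1 = ((n.+1%:R : R)^-1)%:C%C.
  by rewrite fmorphV /= rmorph_nat.
rewrite ltcR invf_plt ?posrE//; apply: lt_le_trans (truncnS_gt _) _.
by rewrite ler_nat.
Qed.

(** Norms take values in [C], on which the order is partial; this is the form
    in which infima of norm-like quantities exist there. *)
Lemma nneg_inf (T : Type) (x0 : T) (f : T -> C) : (forall x, 0 <= f x) ->
  exists d : C, (forall x, d <= f x) /\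
    forall e, 0 < e -> exists x, f x < d + e.
Proof.
move=> f0; pose S := range (fun x => complex.Re (f x)).
have fE x := complex_Re_ge0 (f0 x).
have lS : lbound S 0 by move=> _ [x _ <-]; rewrite -ler0c -fE.
have hS : has_inf S by split; [exists (complex.Re (f x0)), x0|exists 0].
exists (inf S)%:C%C; split.
  by move=> x; rewrite fE lecR; apply: ge_inf; [exists 0|exists x].
move=> e e0; have eE := complex_Re_ge0 (ltW e0).
have r0 : 0 < complex.Re e by move: e0; rewrite ltcE => /andP[].
have [_ [x _ <-] xe] := inf_adherent r0 hS.
by exists x; rewrite fE eE -rmorphD ltcR.
Qed.

Lemma cauchy_seq_cvg (V : completeNormedModType C) (u : nat -> V) :
  (forall e : C, 0 < e -> exists N, forall m n, (N <= m)%N -> (N <= n)%N ->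
     `|u m - u n| < e) ->
  exists l, forall e : C, 0 < e -> exists N, forall n, (N <= n)%N ->
    `|l - u n| < e.
Proof.
move=> uc; have : cvg (u @ \oo).
  apply: cauchy_cvg; apply/cauchy_ballP => e e0; have [N uN] := uc e e0.
  have h : (u @ \oo) (u @` [set n | (N <= n)%N]).
    by apply: filterS (nbhs_infty_ge N) => n Nn; exists n.
  exists (u @` [set n | (N <= n)%N], u @` [set n | (N <= n)%N]) => //.
  by move=> [_ _] /= [[m mN <-] [n nN <-]]; rewrite -ball_normE; exact: uN.
move=> /cvgrPdist_lt ul; exists (lim (u @ \oo)) => e /ul[N _ h].
by exists N.
Qed.

Lemma innerC V (x y : V) : inner x y = (inner y x)^*%R.
Proof. by rewrite hermC /= expr0 mul1r. Qed.

Lemma inner_ge0 V (x : V) : 0 <= inner x x.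
Proof. exact: dnorm_ge0. Qed.

Lemma inner_cs V (x y : V) : `|inner x y| <= `|x| * `|y|.
Proof.
rewrite -(@ler_pXn2r _ 2) ?nnegrE ?mulr_ge0//.
by rewrite exprMn !sqr_normr_inner dot_cauchy_schwarz.
Qed.

Lemma innerZl V a (x y : V) : inner (a *: x) y = a * inner x y.
Proof. by rewrite linearZl_LR. Qed.

Lemma innerZr V a (x y : V) : inner x (a *: y) = a^*%R * inner x y.
Proof. by rewrite linearZr_LR. Qed.

Lemma innerDl U (x y z : U) : inner (x + y) z = inner x z + inner y z.
Proof. by rewrite linearDl. Qed.

Lemma innerDr U (x y z : U) : inner x (y + z) = inner x y + inner x z.
Proof. by rewrite linearDr. Qed.

Lemma innerBl U (x y z : U) : inner (x - y) z = inner x z - inner y z.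
Proof. by rewrite linearBl. Qed.

Lemma innerBr U (x y z : U) : inner x (y - z) = inner x y - inner x z.
Proof. by rewrite linearBr. Qed.

Lemma innerNl U (x z : U) : inner (- x) z = - inner x z.
Proof. by rewrite linearNl. Qed.

Lemma inner_inj V (y z : V) : (forall x, inner x y = inner x z) -> y = z.
Proof.
move=> yz; apply/eqP; rewrite -subr_eq0 -(dnorm_eq0 inner) linearBr /=.
by rewrite yz subrr.
Qed.

Lemma bopP U V (S T : bop U V) : (forall x, S x = T x) -> S = T.
Proof. by move=> ST; apply/val_inj/funext. Qed.

End hilbert_space.

HB.instance Definition _ (R : realType) (U V : hilbertType (Cplx R))
    (T : bop U V) :=
  GRing.isLinear.Build (Cplx R) U V *:%R (bop_fun T) (@bop_linear _ _ _ T).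

Section operators.
Context (R : realType).
Local Notation C := (Cplx R).
Implicit Types U V W : hilbertType C.

Lemma addbE U V (S T : bop U V) x : (S + T) x = S x + T x.
Proof. by []. Qed.
Lemma oppbE U V (S : bop U V) x : (- S) x = - S x.
Proof. by []. Qed.
Lemma zerobE U V x : (0 : bop U V) x = 0.
Proof. by []. Qed.
Lemma scalebE U V a (S : bop U V) x : (a *: S) x = a *: S x.
Proof. by []. Qed.
Lemma bcompE U V W (S : bop V W) (T : bop U V) x : (S *o T) x = S (T x).
Proof. by []. Qed.
Lemma sumbE U V (I : Type) (r : seq I) (P : pred I) (F : I -> bop U V) x :
  (\sum_(i <- r | P i) F i) x = \sum_(i <- r | P i) F i x.
Proof. by elim/big_rec2: _ => // i y T _ <-. Qed.

Lemma bop0 U V (T : bop U V) : T 0 = 0.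
Proof. exact: linear0. Qed.

Lemma bopD U V (T : bop U V) x y : T (x + y) = T x + T y.
Proof. exact: linearD. Qed.

Lemma bopB U V (T : bop U V) x y : T (x - y) = T x - T y.
Proof. exact: linearB. Qed.

Lemma bop_sum (U V : hilbertType C) (T : bop U V) (I : Type) (r : seq I) (F : I -> U) :
  T (\sum_(i <- r) F i) = \sum_(i <- r) T (F i).
Proof. exact: raddf_sum. Qed.

Definition bopE := (addbE, oppbE, zerobE, scalebE, bcompE, sumbE).

Lemma bop_norm_le U V (T : bop U V) x : `|T x| <= `|T| * `|x|.
Proof. exact: bop_le. Qed.

Lemma bop_normP U V (T : bop U V) (M : C) :
  0 <= M -> (forall x, `|T x| <= M * `|x|) -> `|T| <= M.
Proof.
move=> M0 TM; apply: opnorm_le => // x x1.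
by apply: le_trans (TM x) _; rewrite -[leRHS]mulr1 ler_wpM2l.
Qed.

Lemma normb_comp U V W (S : bop V W) (T : bop U V) :
  `|S *o T| <= `|S| * `|T|.
Proof.
apply: bop_normP => [|x]; first exact: mulr_ge0.
apply: le_trans (bop_norm_le S (T x)) _; rewrite -mulrA ler_wpM2l//.
exact: bop_norm_le.
Qed.

Lemma normb_comp3 U V W Z (a : bop W Z) (b : bop V W)
  (c : bop U V) (M : C) : `|a| <= 1 -> `|b| <= M -> `|c| <= 1 ->
  `|a *o b *o c| <= M.
Proof.
move=> a1 bM c1; have M0 : 0 <= M := le_trans (normr_ge0 _) bM.
apply: le_trans (normb_comp _ _) _; rewrite -[leRHS]mulr1 ler_pM//.
by apply: le_trans (normb_comp _ _) _; rewrite -[leRHS]mul1r ler_pM.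
Qed.

Lemma bcompA U V W Z (S : bop W Z) (T : bop V W) (X : bop U V) :
  S *o (T *o X) = S *o T *o X.
Proof. exact: bopP. Qed.

Lemma bcomp0l U V W (T : bop U V) : (0 : bop V W) *o T = 0.
Proof. by apply: bopP => x. Qed.

Lemma bcomp0r U V W (T : bop V W) : T *o (0 : bop U V) = 0.
Proof. by apply: bopP => x; rewrite bcompE !zerobE bop0. Qed.

Lemma bcompDl U V W (S S' : bop V W) (T : bop U V) :
  (S + S') *o T = S *o T + S' *o T.
Proof. exact: bopP. Qed.
Lemma bcompBl U V W (S S' : bop V W) (T : bop U V) :
  (S - S') *o T = S *o T - S' *o T.
Proof. exact: bopP. Qed.
Lemma bcompZl U V W a (S : bop V W) (T : bop U V) :
  (a *: S) *o T = a *: (S *o T).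
Proof. exact: bopP. Qed.
Lemma bcompDr U V W (S : bop V W) (T T' : bop U V) :
  S *o (T + T') = S *o T + S *o T'.
Proof. by apply: bopP => x; rewrite !bopE raddfD. Qed.
Lemma bcompBr U V W (S : bop V W) (T T' : bop U V) :
  S *o (T - T') = S *o T - S *o T'.
Proof. by apply: bopP => x; rewrite !bopE raddfB. Qed.
Lemma bcompZr U V W a (S : bop V W) (T : bop U V) :
  S *o (a *: T) = a *: (S *o T).
Proof. by apply: bopP => x; rewrite !bopE linearZ. Qed.

Definition mkbop U V (f : U -> V) (fl : linear f) (M : C)
    (fM : forall x, `|f x| <= M * `|x|) : bop U V :=
  Bop (asboolT (conj fl (ex_intro _ M fM)) : f \in @bounded_linear R U V).

Definition idb U : bop U U.
Proof.
apply: (@mkbop U U idfun _ 1) => [a x y|x]; first by [].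
by rewrite mul1r.
Defined.

(** The pointwise limit of a Cauchy sequence of operators is linear, and the
    Cauchy estimates are uniform on the unit ball, so it is also the limit in
    norm. *)
Lemma bop_cauchy_cvg U V (u : nat -> bop U V) :
  (forall e : C, 0 < e -> exists N, forall m n, (N <= m)%N -> (N <= n)%N ->
     `|u m - u n| < e) ->
  exists l, forall e : C, 0 < e -> exists N, forall n, (N <= n)%N ->
    `|l - u n| < e.
Proof.
move=> uc.
have ucx x : exists l, forall e : C, 0 < e -> exists N, forall n, (N <= n)%N ->
    `|l - u n x| < e.
  apply: cauchy_seq_cvg => e e0.
  have x1 : 0 < `|x| + 1 by rewrite ltr_wpDl.
  have [|N uN] := uc (e / (`|x| + 1)); first by rewrite divr_gt0.
  exists N => m n mN nN; rewrite -[_ - _]/((u m - u n) x).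
  apply: le_lt_trans (bop_norm_le _ _) _.
  apply: (@le_lt_trans _ _ (`|u m - u n| * (`|x| + 1))).
    by rewrite ler_wpM2l// lerDl.
  by rewrite -ltr_pdivlMr// uN.
have [f uf] := choice ucx.
have key (e : C) : 0 < e -> exists N, forall n, (N <= n)%N ->
    forall x, `|f x - u n x| <= e * `|x|.
  move=> e0; have [N uN] := uc e e0; exists N => n Nn x.
  apply: (@le_of_le_eps _ _ _ 1) => // d d0; have [N' uN'] := uf x d d0.
  pose m := maxn N N'.
  rewrite -(subrK (u m x) (f x)) -addrA mul1r addrC.
  apply: le_trans (ler_normD _ _) _; apply: lerD; last first.
    by apply/ltW/uN'; exact: leq_maxr.
  rewrite -[_ - _]/((u m - u n) x); apply: le_trans (bop_norm_le _ _) _.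
  by rewrite ler_wpM2r// ltW// uN// leq_maxl.
have flin : linear f.
  move=> a x y; apply/eqP; rewrite -subr_eq0 -normr_le0.
  apply: (@le_of_le_eps _ _ _ (`|a *: x + y| + `|a| * `|x| + `|y|)).
    by rewrite !addr_ge0// mulr_ge0.
  move=> e e0; have [N uN] := key e e0; have {}uN := uN _ (leqnn N).
  have -> : f (a *: x + y) - (a *: f x + f y) = (f (a *: x + y) -
     u N (a *: x + y)) - a *: (f x - u N x) - (f y - u N y).
    have -> : u N (a *: x + y) = a *: u N x + u N y by rewrite linearP.
    rewrite scalerBr !opprB -[RHS]addrA [X in _ = _ + X]addrACA.
    by rewrite -(opprD (a *: f x)) [RHS]addrA subrK.
  rewrite add0r !mulrDl.
  apply: le_trans (ler_normB _ _) _; apply: lerD; last by rewrite mulrC.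
  apply: le_trans (ler_normB _ _) _; apply: lerD; first by rewrite mulrC.
  by rewrite normrZ -mulrA ler_wpM2l// mulrC.
have [N1 uN1] := key 1 ltr01.
have fM x : `|f x| <= (1 + `|u N1|) * `|x|.
  rewrite -(subrK (u N1 x) (f x)) mulrDl.
  apply: le_trans (ler_normD _ _) _; apply: lerD; last exact: bop_norm_le.
  exact: uN1.
exists (mkbop flin fM) => e e0; have e20 : 0 < e / 2%:R by rewrite divr_gt0.
have [N uN] := key _ e20; exists N => n Nn.
apply: (@le_lt_trans _ _ (e / 2%:R)).
  by apply: bop_normP => [|x]; [exact: ltW|exact: uN].
by rewrite ltr_pdivrMr// ltr_pMr// ltr1n.
Qed.

End operators.

(** * The Riesz representation theorem *)

Section riesz.
Context (R : realType).
Local Notation C := (Cplx R).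
Implicit Types U V W : hilbertType C.

(** Minimize J(x) = |Q x|^2 - 2 Re phi(x), which is bounded below by the
    hypothesis on [phi].  By the parallelogram identity the vectors Q x along a
    minimizing sequence form a Cauchy sequence, and the variational inequality
    makes their limit [z] represent [phi].  For [Q] the identity this is the
    usual theorem.  In general [z] lies in the closure of the range of [Q],
    and that determines it. *)
Lemma riesz_range U W (Q : bop U W) (phi : U -> C) (M : C) : 0 <= M ->
  (forall a x y, phi (a *: x + y) = a * phi x + phi y) ->
  (forall x, `|phi x| <= M * `|Q x|) ->
  exists z, [/\ forall e : C, 0 < e -> exists x, `|z - Q x| < e,
    forall x, phi x = inner (Q x) z & `|z| <= M].
Proof.
move=> M0 phiP phiM.
have phiD x y : phi (x + y) = phi x + phi y by rewrite -{1}[x]scale1r phiP mul1r.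
have phi0 : phi 0 = 0 by apply: (addIr (phi 0)); rewrite -phiD !add0r.
have phiZ a x : phi (a *: x) = a * phi x by rewrite -[_ *: _]addr0 phiP phi0 addr0.
(* The summand M ^+ 2 only makes J nonnegative. *)
pose J x := inner (Q x) (Q x) - (phi x + (phi x)^*%R) + M ^+ 2.
have J0 x : 0 <= J x.
  have h : phi x + (phi x)^*%R <= (M * `|Q x|) *+ 2.
    have -> : phi x + (phi x)^*%R = 'Re (phi x) *+ 2.
      by rewrite ReE -[X in X = _]divr1 -mulrnAl -mulr_natr mulfK ?pnatr_eq0 ?divr1.
    rewrite lerMn2r /=; apply: le_trans (phiM x).
    exact: (leif_Re_Creal _).1.
  have : 0 <= (`|Q x| - M) ^+ 2.
    by rewrite real_exprn_even_ge0// realB// ?normr_real// ger0_real.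
  rewrite sqrrB sqr_normr_inner => h2; apply: le_trans h2 _.
  by rewrite /J lerD2r lerD2l lerN2 mulrC.
have [d [dJ Jd]] := nneg_inf 0 J0.
have Jdn n : exists x, J x < d + (n.+1%:R)^-1 by apply: Jd; rewrite invr_gt0.
have [x xP] := choice Jdn.
(* The parallelogram identity: phi cancels because J is quadratic plus affine. *)
have par u v : `|Q u - Q v| ^+ 2 = 2%:R * J u + 2%:R * J v -
    4%:R * J (2%:R^-1 *: (u + v)).
  have n2 : 2%:R != 0 :> C by rewrite pnatr_eq0.
  have QE : Q (2%:R^-1 *: (u + v)) = 2%:R^-1 *: (Q u + Q v).
    by rewrite linearZ linearD.
  rewrite sqr_normr_inner dnormB /J QE dnormZ dnormD.
  have cE : (2%:R^-1 * (phi u + phi v))^*%R =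
      2%:R^-1 * ((phi u)^*%R + (phi v)^*%R).
    rewrite rmorphM rmorphD; congr (_ * _); apply: conj_Creal.
    by rewrite realV realn.
  rewrite phiZ phiD cE normfV normr_nat.
  by field.
have xc (e : C) : 0 < e -> exists N, forall m n, (N <= m)%N -> (N <= n)%N ->
    `|Q (x m) - Q (x n)| < e.
  move=> e0; have e4 : 0 < e ^+ 2 / 4%:R by rewrite divr_gt0// exprn_gt0.
  have [N hN] := invn_lt_eps e4; exists N => m n mN nN.
  rewrite -(@ltr_pXn2r _ 2) ?nnegrE//; last exact: ltW.
  rewrite par.
  apply: (@le_lt_trans _ _ (2%:R * J (x m) + 2%:R * J (x n) - 4%:R * d)).
    by rewrite lerD2l lerN2 ler_wpM2l.
  have -> : 2%:R * J (x m) + 2%:R * J (x n) - 4%:R * d =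
    2%:R * ((J (x m) - d) + (J (x n) - d)) by ring.
  rewrite -ltr_pdivlMl//.
  have -> : 2%:R^-1 * e ^+ 2 = e ^+ 2 / 4%:R + e ^+ 2 / 4%:R by field.
  by apply: ltrD; rewrite ltrBlDl; apply: lt_trans (xP _) _; rewrite ltrD2l hN.
have [z zP] := cauchy_seq_cvg xc.
have zx (e : C) : 0 < e -> exists y, `|z - Q y| < e.
  by move=> /zP[N hN]; exists (x N); apply: hN.
(* The derivative of J at x n in the direction v is almost zero: test
   minimality at x n + t v with t = - s conj(w), the steepest descent. *)
have main v n : `|inner (Q v) (Q (x n)) - phi v| ^+ 2 <=
    (n.+1%:R)^-1 * (`|Q v| ^+ 2 + 1).
  set w := _ - _.
  have wE : inner (Q v) (Q (x n)) = w + phi v by rewrite subrK.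
  clearbody w; pose q := `|Q v| ^+ 2; pose s := (q + 1)^-1.
  have q1 : 0 < q + 1 by rewrite ltr_wpDl// exprn_ge0.
  have s0 : 0 < s by rewrite invr_gt0.
  have sC : s^*%R = s by apply: conj_Creal; exact: gtr0_real.
  have Jv : J (x n + (- s * w^*%R) *: v) =
      J (x n) - (2%:R * s - s ^+ 2 * q) * `|w| ^+ 2.
    have QE : Q (x n + (- s * w^*%R) *: v) = Q (x n) + (- s * w^*%R) *: Q v.
      by rewrite linearD linearZ.
    rewrite /J QE dnormD dnormZ phiD phiZ innerZr (innerC (Q (x n)) (Q v)).
    rewrite wE.
    have tE : (- s * w^*%R)^*%R = - s * w
      by rewrite rmorphM rmorphN /= conjCK sC.
    have conjD (a b : C) : (a + b)^*%R = a^*%R + b^*%R by rewrite rmorphD.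
    have conjM (a b : C) : (a * b)^*%R = a^*%R * b^*%R by rewrite rmorphM.
    have NsC : (- s)^*%R = - s by rewrite rmorphN /= sC.
    rewrite !conjD !conjM !conjD !conjCK NsC.
    rewrite -[inner (Q v) (Q v)]sqr_normr_inner -/q normrM normrN norm_conjC.
    rewrite (ger0_norm (ltW s0)) exprMn normCK; ring.
  have := dJ (x n + (- s * w^*%R) *: v); rewrite Jv.
  rewrite lerBrDl -lerBrDr => h.
  have {h} : s * `|w| ^+ 2 <= (n.+1%:R)^-1.
    apply: (@le_trans _ _ ((2%:R * s - s ^+ 2 * q) * `|w| ^+ 2)).
      rewrite ler_wpM2r ?exprn_ge0//.
      have -> : 2%:R * s - s ^+ 2 * q = s + s * (1 - s * q) by ring.
      rewrite lerDl mulr_ge0 ?ltW// subr_gt0 mulrC ltr_pdivrMr// mul1r.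
      by rewrite ltrDl.
    by apply: le_trans h _; rewrite lerBlDl; apply/ltW/xP.
  by rewrite /s mulrC ler_pdivrMr.
have zphi v : phi v = inner (Q v) z.
  apply/eqP; rewrite -subr_eq0; apply/eqP.
  apply: (@norm_le_eps_eq0 _ _ (`|Q v| + 1)) => [|e e0]; first by rewrite addr_ge0.
  have [N1 h1] := zP _ e0.
  have q1 : 0 < `|Q v| ^+ 2 + 1 by rewrite ltr_wpDl// exprn_ge0.
  have e2 : 0 < e ^+ 2 / (`|Q v| ^+ 2 + 1) by rewrite divr_gt0// exprn_gt0.
  have [N2 h2] := invn_lt_eps e2; pose n := maxn N1 N2.
  have -> : phi v - inner (Q v) z =
      - (inner (Q v) (Q (x n)) - phi v) - inner (Q v) (z - Q (x n)).
    by rewrite linearBr /=; ring.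
  apply: le_trans (ler_normB _ _) _; rewrite normrN mulrDl addrC mul1r.
  apply: lerD.
    apply: le_trans (inner_cs _ _) _; rewrite ler_wpM2l// ltW// h1//.
    exact: leq_maxl.
  rewrite -(@ler_pXn2r _ 2) ?nnegrE//; last exact: ltW.
  apply: le_trans (main v n) _; rewrite -ler_pdivlMr// ltW// h2//.
  exact: leq_maxr.
exists z; split=> //.
have [->|z0] := eqVneq z 0; first by rewrite normr0.
have nz : 0 < `|z| by rewrite normr_gt0.
rewrite -(ler_pM2r nz) -expr2 sqr_normr_inner.
apply: (@le_of_le_eps _ _ _ (`|z| + M)) => [|e e0]; first by rewrite addr_ge0.
have [y yP] := zx e e0.
have -> : inner z z = inner (z - Q y) z + inner (Q y) z.
  by rewrite linearBl /= subrK.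
rewrite -[inner (z - _) _ + _]ger0_norm; last by rewrite linearBl /= subrK inner_ge0.
apply: le_trans (ler_normD _ _) _.
have -> : M * `|z| + (`|z| + M) * e = e * `|z| + M * (e + `|z|) by ring.
apply: lerD.
  by apply: le_trans (inner_cs _ _) _; rewrite ler_wpM2r// ltW.
rewrite -zphi.
apply: le_trans (phiM y) _; rewrite ler_wpM2l// -(subrK z (Q y)).
by apply: le_trans (ler_normD _ _) _; rewrite lerD2r distrC ltW.
Qed.

End riesz.

(** * Adjoints and factorization of operators *)

Section adjoint.
Context (R : realType).
Local Notation C := (Cplx R).
Implicit Types U V W : hilbertType C.

(** The functional x |-> <T x, y> is bounded by |Q x|, so it is represented by
    a vector S y in the closure of the range of [Q].  Linearity of [S] follows
    from the uniqueness of this vector. *)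
Lemma douglas_majorization U V W (Q : bop U V) (T : bop U W) (M : C) : 0 <= M ->
  (forall x, `|T x| <= M * `|Q x|) ->
  exists S : bop W V, `|S| <= M /\ forall x y, inner (T x) y = inner (Q x) (S y).
Proof.
move=> M0 TQ.
have ex (y : W) : exists z : V, [/\ forall e : C, 0 < e -> exists x, `|z - Q x| < e,
    forall x, inner (T x) y = inner (Q x) z & `|z| <= M * `|y|].
  apply: (@riesz_range R U V Q (fun x => inner (T x) y)); first exact: mulr_ge0.
    by move=> a u v; rewrite bop_linear innerDl innerZl.
  move=> x; apply: le_trans (inner_cs _ _) _; rewrite mulrAC ler_wpM2r//.
have [f fP] := choice ex.
have flin : linear f.
  move=> a y y'; apply/eqP; rewrite -subr_eq0; apply/eqP.
  set z := _ - _.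
  have zQ x : inner (Q x) z = 0.
    have [_ h1 _] := fP (a *: y + y'); have [_ h2 _] := fP y.
    have [_ h3 _] := fP y'.
    rewrite /z innerBr !innerDr innerZr -h1 -h2 -h3 innerDr innerZr.
    by rewrite subrr.
  (* z is orthogonal to the range of Q and belongs to its closure. *)
  have zlim (e : C) : 0 < e -> exists x, `|z - Q x| <= (1 + `|a| + 1) * e.
    move=> e0; have [h1 _ _] := fP (a *: y + y'); have [h2 _ _] := fP y.
    have [h3 _ _] := fP y'; have [x1 {}h1] := h1 e e0; have [x2 {}h2] := h2 e e0.
    have [x3 {}h3] := h3 e e0; exists (x1 - (a *: x2 + x3)).
    have -> : z - Q (x1 - (a *: x2 + x3)) = (f (a *: y + y') - Q x1)
       - (a *: (f y - Q x2) + (f y' - Q x3)).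
      rewrite bopB bop_linear /z opprB scalerBr.
      rewrite [a *: f y - _ + _]addrACA -(opprD (a *: Q x2)) opprB.
      by rewrite [LHS]addrACA [RHS]addrACA [X in _ + X]addrC.
    apply: le_trans (ler_normB _ _) _; rewrite !mulrDl !mul1r -addrA.
    apply: lerD; first exact: ltW.
    apply: le_trans (ler_normD _ _) _; apply: lerD; last exact: ltW.
    by rewrite normrZ ler_wpM2l// ltW.
  apply/eqP; rewrite -normr_eq0 -sqrf_eq0; apply/eqP.
  apply: (@norm_le_eps_eq0 _ _ ((1 + `|a| + 1) * `|z|)) => [|e e0].
    by rewrite mulr_ge0// !addr_ge0.
  have [x xP] := zlim e e0.
  rewrite sqr_normr_inner -[X in `|X|]subr0 -(zQ x) -innerBl.
  apply: le_trans (inner_cs _ _) _.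
  by rewrite [leRHS]mulrAC ler_wpM2r.
have fM y : `|f y| <= M * `|y| by have [] := fP y.
exists (mkbop flin fM); split; first exact: bop_normP.
by move=> x y; have [_ h _] := fP y; exact: h.
Qed.

Lemma adjP U V (T : bop U V) x y : inner (T x) y = inner x (adj T y).
Proof.
rewrite /adj; case: xgetP => [S _ ->//|h]; exfalso.
have [|S [_ SP]] := @douglas_majorization U U V (idb U) T `|T| (normr_ge0 _).
  by move=> z; exact: bop_norm_le.
by apply: (h S) => u v; exact: SP.
Qed.

Lemma adjPl U V (T : bop U V) x y : inner (adj T x) y = inner x (T y).
Proof. by rewrite innerC -adjP -innerC. Qed.

Lemma adj_unique U V (T : bop U V) (S : bop V U) :
  (forall x y, inner (T x) y = inner x (S y)) -> adj T = S.
Proof.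
by move=> TS; apply: bopP => y; apply: inner_inj => x; rewrite -adjP TS.
Qed.

Lemma adjK U V (T : bop U V) : adj (adj T) = T.
Proof. by apply: adj_unique => x y; rewrite adjPl. Qed.

Lemma adjM U V W (S : bop V W) (T : bop U V) : adj (S *o T) = adj T *o adj S.
Proof. by apply: adj_unique => x y; rewrite !bcompE !adjP. Qed.

Lemma adjD U V (S T : bop U V) : adj (S + T) = adj S + adj T.
Proof. by apply: adj_unique => x y; rewrite !bopE innerDl innerDr !adjP. Qed.

Lemma adjZ U V a (T : bop U V) : adj (a *: T) = a^*%R *: adj T.
Proof. by apply: adj_unique => x y; rewrite !bopE innerZl innerZr conjCK adjP. Qed.

Lemma adjB U V (S T : bop U V) : adj (S - T) = adj S - adj T.
Proof. by apply: adj_unique => x y; rewrite !bopE innerBl innerBr !adjP. Qed.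

Lemma normb_adj U V (T : bop U V) : `|adj T| <= `|T|.
Proof.
apply: bop_normP => // y.
have [->|n0] := eqVneq (adj T y) 0; first by rewrite normr0 mulr_ge0.
have nz : 0 < `|adj T y| by rewrite normr_gt0.
rewrite -(ler_pM2r nz) -expr2 sqr_normr_inner -adjP.
rewrite -[inner _ _]ger0_norm; last by rewrite adjP inner_ge0.
apply: le_trans (inner_cs _ _) _; rewrite mulrAC ler_wpM2r//.
exact: bop_norm_le.
Qed.

Lemma adj_inj U V : injective (@adj R U V).
Proof. by move=> S T ST; rewrite -(adjK S) ST adjK. Qed.

Lemma sqr_norm_adj U V (T : bop U V) x : `|T x| ^+ 2 = inner ((adj T *o T) x) x.
Proof. by rewrite sqr_normr_inner bcompE adjPl. Qed.

(** The form <T x, x> is real; polarization with the scalars 1 and i turns this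
    into the symmetry of [T]. *)
Lemma op_ge0_selfadj U (T : bop U U) : op_ge0 T -> adj T = T.
Proof.
move=> T0.
have sym x : inner (T x) x = inner x (T x).
  by rewrite [RHS]innerC conj_Creal// ger0_real.
apply: adj_unique => x y.
have := sym (x + y); rewrite bopD !innerDl !innerDr !sym => e1.
have := sym (x + 'i *: y); rewrite bopD bopZ !innerDl !innerDr.
rewrite !innerZl !innerZr conjCi !sym => e2.
move: e1 e2; set a := inner x (T x); set b := inner y (T y).
set p := inner (T x) y; set q := inner (T y) x.
set r := inner x (T y); set s := inner y (T x) => e1 e2.
have {}e1 : p + q = r + s.
  have -> : p + q = (a + p + (q + b)) - a - b by ring.
  by rewrite e1; ring.
have {}e2 : q - p = s - r.
  apply: (mulfI (neq0Ci C)).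
  have -> : 'i * (q - p) = (a + - 'i * p + ('i * q + 'i * (- 'i * b))) - a
    + 'i * 'i * b by ring.
  by rewrite e2; ring.
have n2 : 2%:R != 0 :> C by rewrite pnatr_eq0.
apply: (mulfI n2).
have -> : 2%:R * p = (p + q) - (q - p) by ring.
by rewrite e1 e2; ring.
Qed.

(** This replaces the polar decomposition: with [Q] a square root of T^* T it
    factors [T] through its modulus. *)
Lemma douglas_factor U V W (Q : bop U V) (T : bop U W) :
  (forall x, `|T x| <= `|Q x|) -> exists S : bop V W, `|S| <= 1 /\ T = S *o Q.
Proof.
move=> TQ; have [|S [S1 SP]] := @douglas_majorization U V W Q T 1 ler01.
  by move=> x; rewrite mul1r.
exists (adj S); split; first exact: le_trans (normb_adj S) S1.
by apply: bopP => x; apply: inner_inj => y; rewrite bcompE -adjP [LHS]innerC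
  SP -innerC.
Qed.

End adjoint.

(** * Norm-closed sets and square roots of positive operators *)

Section square_root.
Context (R : realType).
Local Notation C := (Cplx R).
Implicit Types U V W : hilbertType C.

(** Closedness in epsilon form, as sets cut out by Lipschitz maps provide
    it ([norm_closed_eq], [norm_closed_preimage]). *)
Definition norm_closed (V : normedModType C) (P : set V) : Prop :=
  forall x, (forall e : C, 0 < e -> exists2 y, P y & `|x - y| < e) -> P x.

Lemma closureE_norm (V : normedModType C) (P : set V) x :
  closure P x <-> forall e : C, 0 < e -> exists2 y, P y & `|x - y| < e.
Proof.
split=> [cx e e0|h B /nbhs_normP[e e0 eB]].
  have [y [Py]] := cx _ (nbhsx_ballx x _ e0).
  by rewrite -ball_normE; exists y.
have [y Py ye] := h e e0; exists y; split=> //.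
exact: eB.
Qed.

Lemma closed_norm_closed (V : normedModType C) (P : set V) :
  closed P -> norm_closed P.
Proof. by move=> cP x /closureE_norm /cP. Qed.

Lemma norm_closedI (V : normedModType C) (P Q : set V) :
  norm_closed P -> norm_closed Q -> norm_closed (P `&` Q).
Proof.
by move=> cP cQ x h; split; [apply: cP|apply: cQ] => e /h[y [] ? ?]; exists y.
Qed.

Lemma norm_closed_eq (V W : normedModType C) (f g : V -> W) (k : C) : 0 <= k ->
  (forall x y, `|f x - f y| <= k * `|x - y|) ->
  (forall x y, `|g x - g y| <= k * `|x - y|) -> norm_closed [set x | f x = g x].
Proof.
move=> k0 fk gk x h; apply/eqP; rewrite -subr_eq0 -normr_le0.
apply: (@le_of_le_eps _ _ _ (k + k)) => [|e e0]; first exact: addr_ge0.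
have [y /= fg ye] := h e e0; rewrite add0r.
have -> : f x - g x = (f x - f y) - (g x - g y).
  by rewrite fg opprB addrA subrK.
apply: le_trans (ler_normB _ _) _; rewrite mulrDl; apply: lerD.
  by apply: le_trans (fk _ _) _; rewrite ler_wpM2l// ltW.
by apply: le_trans (gk _ _) _; rewrite ler_wpM2l// ltW.
Qed.

Lemma norm_closed_preimage (V W : normedModType C) (f : V -> W) (Q : set W) (k : C) :
  0 <= k -> (forall x y, `|f x - f y| <= k * `|x - y|) -> norm_closed Q ->
  norm_closed [set x | Q (f x)].
Proof.
move=> k0 fk Qc x h; apply: Qc => e e0.
have k1 : 0 < k + 1 by rewrite ltr_wpDl.
have [y Qy xy] := h (e / (k + 1)) (divr_gt0 e0 k1); exists (f y) => //.
apply: le_lt_trans (fk x y) _.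
apply: (@le_lt_trans _ _ ((k + 1) * `|x - y|)); first by rewrite ler_wpM2r// lerDl.
by rewrite mulrC -ltr_pdivlMr.
Qed.

Lemma norm_closed_selfadj U : norm_closed [set T : bop U U | adj T = T].
Proof.
apply: (@norm_closed_eq _ _ (@adj R U U) id 1) => // X Y; rewrite mul1r//.
by rewrite -adjB normb_adj.
Qed.

(** The iteration q_(n+1) = (T + q_n^2) / 2 is dominated by the scalar
    iteration s_(n+1) = (1 + s_n^2) / 2, in the sense that
    |q_(n+1) - q_n| <= s_(n+1) - s_n, and [s] increases and is bounded by 1.
    So [q] converges in norm even when |T| = 1.  The set [P] records whatever
    the iteration preserves, such as membership in a C*-algebra. *)
Lemma quadratic_root U (T : bop U U) (P : set (bop U U)) :
  `|T| <= 1 -> P 0 -> (forall X, P X -> P (2%:R^-1 *: (T + X *o X))) ->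
  norm_closed P ->
  exists c, [/\ P c, `|c| <= 1 & T + c *o c = 2%:R *: c].
Proof.
move=> T1 P0 PS Pcl.
pose q := fix q n := if n is m.+1 then 2%:R^-1 *: (T + q m *o q m) else 0.
pose s := fix s n : C := if n is m.+1 then 2%:R^-1 * (1 + s m * s m) else 0.
have h2 : (0 : C) <= 2%:R^-1 by rewrite invr_ge0.
have s01 n : 0 <= s n <= 1.
  elim: n => [|n /andP[s0 s1]] /=; first by rewrite lexx ler01.
  rewrite mulr_ge0 ?addr_ge0 ?mulr_ge0//= mulrC ler_pdivrMr// mul1r.
  by rewrite -[2%:R]/(1 + 1 : C) lerD2l mulr_ile1.
have s0 n : 0 <= s n by case/andP: (s01 n).
have s1 n : s n <= 1 by case/andP: (s01 n).
have sincr n : s n <= s n.+1.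
  elim: n => [|n IH]; first exact: s0.
  by rewrite [s n.+1]/= [s n.+2]/= ler_wpM2l// lerD2l ler_pM.
have smono m n : (m <= n)%N -> s m <= s n.
  by move=> /subnK <-; elim: (_ - _)%N => // k IH; apply: le_trans IH (sincr _).
have qs n : `|q n| <= s n.
  elim: n => [|n IH] /=; first by rewrite normr0.
  rewrite normrZ (ger0_norm h2) ler_wpM2l//.
  apply: le_trans (ler_normD _ _) _; apply: lerD => //.
  by apply: le_trans (normb_comp _ _) _; apply: ler_pM.
have qincr n : `|q n.+1 - q n| <= s n.+1 - s n.
  elim: n => [|n IH].
    rewrite /= !subr0 mulr0 addr0 mulr1 normrZ (ger0_norm h2) ler_piMr//.
    by rewrite bcomp0l addr0.
  have -> : q n.+2 - q n.+1 = 2%:R^-1 *: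
      ((q n.+1 - q n) *o q n.+1 + q n *o (q n.+1 - q n)).
    have qS m : q m.+1 = 2%:R^-1 *: (T + q m *o q m) by [].
    rewrite (qS n.+1) [X in _ - X = _]qS -scalerBr bcompBl bcompBr subrKA.
    by rewrite opprD addrACA subrr add0r.
  have -> : s n.+2 - s n.+1 = 2%:R^-1 *
      ((s n.+1 - s n) * s n.+1 + s n * (s n.+1 - s n)).
    have sS m : s m.+1 = 2%:R^-1 * (1 + s m * s m) by [].
    by rewrite (sS n.+1) [X in _ - X = _]sS; ring.
  rewrite normrZ (ger0_norm h2) ler_wpM2l//.
  apply: le_trans (ler_normD _ _) _; apply: lerD;
    by apply: le_trans (normb_comp _ _) _; apply: ler_pM.
have qmono m n : (m <= n)%N -> `|q n - q m| <= s n - s m.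
  move=> /subnK <-; elim: (_ - _)%N => [|k IH]; first by rewrite !subrr normr0.
  rewrite addSn -(subrKA (q (k + m)%N)) -(subrKA (s (k + m)%N)).
  by apply: le_trans (ler_normD _ _) _; apply: lerD.
have s1' n : 0 <= 1 - s n by rewrite subr_ge0.
have [d [ds sd]] := nneg_inf 0%N s1'.
have qc (e : C) : 0 < e -> exists N, forall m n, (N <= m)%N -> (N <= n)%N ->
    `|q m - q n| < e.
  move=> /sd[N sN]; exists N.
  have key m n : (N <= m)%N -> (m <= n)%N -> `|q n - q m| < e.
    move=> Nm mn; apply: le_lt_trans (qmono _ _ mn) _.
    have -> : s n - s m = (1 - s m) - (1 - s n) by ring.
    rewrite ltrBlDl; apply: (@le_lt_trans _ _ (1 - s N)).
      by rewrite lerD2l lerN2 smono.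
    by apply: lt_le_trans sN _; rewrite lerD2r.
  move=> m n mN nN; have [mn|nm] := leqP m n; first by rewrite distrC key.
  by apply: key => //; exact: ltnW.
have [c cP] := bop_cauchy_cvg qc.
have Pq n : P (q n) by elim: n => //= n; exact: PS.
have c1 : `|c| <= 1.
  apply: (@le_of_le_eps _ _ _ 1) => // e /cP[N cN]; have := cN _ (leqnn N).
  rewrite mul1r -{2}(subrK (q N) c) => h.
  apply: le_trans (ler_normD _ _) _; rewrite addrC lerD//; last exact: ltW.
  exact: le_trans (qs N) (s1 N).
exists c; split=> //.
  by apply: Pcl => e /cP[N cN]; exists (q N) => //; exact: cN.
apply/eqP; rewrite -subr_eq0 -normr_le0.
apply: (@le_of_le_eps _ _ _ 4%:R) => // e /cP[N cN]; rewrite add0r.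
have h1 := cN _ (leqnn N); have h3 := cN _ (leqnSn N).
have -> : T + c *o c - 2%:R *: c = (c - q N) *o c + q N *o (c - q N)
    - 2%:R *: (c - q N.+1).
  rewrite bcompBl bcompBr subrKA scalerBr /= scalerA mulfV ?pnatr_eq0//.
  by rewrite scale1r opprB addrA; congr (_ - _); rewrite addrCA subrK.
apply: le_trans (ler_normB _ _) _.
have -> : 4%:R * e = e * 1 + 1 * e + 2%:R * e by ring.
apply: lerD.
  apply: le_trans (ler_normD _ _) _; apply: lerD;
    apply: le_trans (normb_comp _ _) _; apply: ler_pM => //; try exact: ltW.
  exact: le_trans (qs N) (s1 N).
by rewrite normrZ ger0_norm// ler_wpM2l// ltW.
Qed.

(** Scale so that |B| < 1.  Then 1 - B^* B has norm at most 1, and if [c] is a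
    root for it in the sense of [quadratic_root], then (1 - c)^2 = B^* B; the
    bound |c| <= 1 makes 1 - c positive.  Restricting to operators of the form
    B^* B makes the estimate |1 - B^* B| <= 1 elementary. *)
Lemma sqrt_exists U W (B : bop U W) :
  exists S, op_ge0 S /\ S *o S = adj B *o B.
Proof.
(* The summand 1 avoids the case B = 0. *)
pose k : C := `|B| + 1; have k0 : 0 < k by rewrite ltr_wpDl.
pose T := k^-2 *: (adj B *o B).
have Tself : adj T = T.
  by rewrite /T adjZ adjM adjK conj_Creal// realV realX// gtr0_real.
have BkB x : `|B x| ^+ 2 <= k ^+ 2 * `|x| ^+ 2.
  rewrite -exprMn ler_pXn2r ?nnegrE ?mulr_ge0//; last exact: ltW.
  apply: le_trans (bop_norm_le _ _) _; rewrite ler_wpM2r//.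
  by rewrite lerDl.
have TE x : inner (T x) x = k^-2 * `|B x| ^+ 2.
  by rewrite /T scalebE innerZl sqr_norm_adj.
have k2 : 0 < k^-2 by rewrite invr_gt0 exprn_gt0.
have T2 x : `|T x| ^+ 2 <= inner (T x) x.
  rewrite TE {1}/T scalebE bcompE normrZ exprMn (gtr0_norm k2).
  rewrite [(k^-2) ^+ 2]expr2 -mulrA ler_wpM2l//; first exact: ltW.
  rewrite ler_pdivrMl ?exprn_gt0//.
  rewrite -exprMn ler_pXn2r ?nnegrE ?mulr_ge0//; last exact: ltW.
  apply: le_trans (bop_norm_le _ _) _; rewrite ler_wpM2r//.
  by apply: le_trans (normb_adj _) _; rewrite lerDl.
have a1 : `|idb U - T| <= 1.
  apply: bop_normP => // x; rewrite mul1r.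
  rewrite -(@ler_pXn2r _ 2) ?nnegrE// sqr_normr_inner bopE oppbE.
  rewrite -[idb U x]/x innerBl !innerBr -(adjPl T) Tself -!sqr_normr_inner.
  rewrite -subr_ge0.
  have -> : `|x| ^+ 2 - (`|x| ^+ 2 - inner (T x) x - (inner (T x) x - `|T x| ^+ 2))
    = inner (T x) x + (inner (T x) x - `|T x| ^+ 2) by ring.
  by rewrite addr_ge0 ?subr_ge0// TE mulr_ge0 ?exprn_ge0// ltW.
have idself : adj (idb U) = idb U by apply: adj_unique.
(* The root is taken for 1 - T, so that 1 - c is the square root of T. *)
have [||c [cself c1 cE]] := quadratic_root a1 _ _ (@norm_closed_selfadj U).
- by apply: adj_unique => x y; rewrite !bopE linear0l linear0r.
- move=> X /= Xs; rewrite adjZ adjD adjB adjM Xs idself Tself conj_Creal//.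
  by rewrite realV realn.
exists (k *: (idb U - c)); split.
  move=> x; rewrite scalebE innerZl mulr_ge0//; first exact: ltW.
  rewrite bopE oppbE innerBl -[idb U x]/x subr_ge0 -sqr_normr_inner.
  have re : inner (c x) x \is Num.real.
    by apply/CrealP; rewrite -innerC -(adjPl c) cself.
  apply: le_trans (real_ler_norm re) _; apply: le_trans (inner_cs _ _) _.
  rewrite expr2 ler_wpM2r//; apply: le_trans (bop_norm_le _ _) _.
  by rewrite ler_piMl.
have kk : k != 0 by rewrite gt_eqF.
have -> : adj B *o B = k ^+ 2 *: T by rewrite /T scalerA mulfV ?scale1r ?expf_neq0.
rewrite bcompZl bcompZr scalerA -expr2; congr (_ *: _).
rewrite bcompBl !bcompBr.
have idl (X : bop U U) : idb U *o X = X by apply: bopP.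
have idr (X : bop U U) : X *o idb U = X by apply: bopP.
rewrite !idl idr opprB addrACA -opprD -mulr2n -scaler_nat -cE.
by rewrite opprD addrACA subrr addr0 opprB addrC subrK.
Qed.

Lemma op_sqrtP U W (B : bop U W) (T := adj B *o B) :
  [/\ op_ge0 (op_sqrt T), op_sqrt T *o op_sqrt T = T,
      adj (op_sqrt T) = op_sqrt T & forall x, `|op_sqrt T x| = `|B x|].
Proof.
have [S0 SS] : op_ge0 (op_sqrt T) /\ op_sqrt T *o op_sqrt T = T.
  rewrite /op_sqrt; case: xgetP => [S _ //|h]; exfalso.
  by have [S hS] := sqrt_exists B; exact: (h S).
have sa := op_ge0_selfadj S0; split=> // x.
apply/eqP; rewrite -(@eqrXn2 _ 2)//; apply/eqP.
by rewrite !sqr_norm_adj sa SS.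
Qed.

End square_root.

(** * Operators on square-summable families *)

Section l2_operators.
Context (R : realType).
Local Notation C := (Cplx R).
Implicit Types (U V W : hilbertType C) (I J : choiceType).

Lemma partial_sumE I (V : zmodType) (x : I -> V) (J : {fset I}) :
  partial_sum x J = \sum_(i <- J) x i.
Proof. by rewrite /partial_sum -(big_seq_fsetE _ _ xpredT x). Qed.

(** The order of [C] is partial, so positivity of a limit is obtained from
    |l| = l, to which the equations |f t| = f t pass. *)
Lemma cvg_nneg (T : Type) (F : set_system T) (FF : ProperFilter F) (f : T -> C) l :
  f @ F --> l -> (forall t, 0 <= f t) -> 0 <= l.
Proof.
move=> /cvgrPdist_lt fl f0; apply/normr_idP/eqP; rewrite -subr_eq0; apply/eqP.
apply: (@norm_le_eps_eq0 _ _ 2%:R) => // e /fl /filter_ex[t].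
move=> /= /ltW h.
have -> : `|l| - l = (`|l| - `|f t|) - (l - f t) by rewrite (ger0_norm (f0 t)); ring.
apply: le_trans (ler_normB _ _) _; rewrite mulr_natl mulr2n lerD//.
apply: le_trans h.
rewrite real_ler_norml ?realB// lerB_dist andbT lerNl opprB distrC.
exact: lerB_dist.
Qed.

Lemma l2_sqr_norm_cvg I U (u : l2 I U) :
  partial_sum (fun i => `|l2_fun u i| ^+ 2) @ totally --> `|u| ^+ 2.
Proof.
have [l [ul _]] := l2_sqr_cvg u; suff -> : `|u| ^+ 2 = l by [].
rewrite l2_sqr_norm; apply: sum_unique; move: ul.
by under eq_fun do rewrite sqr_normr_inner.
Qed.

Lemma l2_partial_le I U (u : l2 I U) K :
  partial_sum (fun i => `|l2_fun u i| ^+ 2) K <= `|u| ^+ 2.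
Proof.
have [l [ul ub]] := l2_sqr_cvg u; suff -> : `|u| ^+ 2 = l by [].
by apply: cvg_unique ul; [exact: norm_hausdorff|exact: l2_sqr_norm_cvg].
Qed.

(** A finite sum of squared norms, each of which is an infinite sum, is
    controlled by summing over the inner index set only finitely often. *)
Lemma l2_sum_le I U (K : Type) (r : seq K) (v : K -> l2 I U) (M : C) :
  (forall L : {fset I},
    \sum_(k <- r) partial_sum (fun i => `|l2_fun (v k) i| ^+ 2) L <= M) ->
  \sum_(k <- r) `|v k| ^+ 2 <= M.
Proof.
move=> vM; rewrite -subr_ge0.
apply: (@cvg_nneg _ totally _ (fun L : {fset I} =>
  M - \sum_(k <- r) partial_sum (fun i => `|l2_fun (v k) i| ^+ 2) L)).
  apply: cvgB; first exact: cvg_cst.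
  by apply: cvg_sum_seq => k; exact: l2_sqr_norm_cvg.
by move=> L; rewrite subr_ge0.
Qed.

Lemma l2_inner_single I U (i : I) (x : U) (u : l2 I U) :
  inner (single i x : l2 I U) u = inner x (l2_fun u i).
Proof.
apply: sum_unique; apply: cvg_near_cst; exists [fset i]%fset => //= J iJ.
rewrite partial_sumE (big_fsetD1 i) /=; last by rewrite -fsub1set.
rewrite eqxx big_seq_cond big1 ?addr0// => j.
by rewrite !inE => /andP[/andP[/negPf -> _] _]; rewrite linear0l.
Qed.

Lemma single_eq I U (i : I) (x : U) : l2_fun (single i x) i = x.
Proof. by rewrite /= eqxx. Qed.

Lemma single_neq I U (i j : I) (x : U) : j != i -> l2_fun (single i x) j = 0.
Proof. by move=> /negPf /= ->. Qed.

Lemma l2_funD I U (u v : l2 I U) i : l2_fun (u + v) i = l2_fun u i + l2_fun v i.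
Proof. by []. Qed.

Lemma l2_funZ I U a (u : l2 I U) i : l2_fun (a *: u) i = a *: l2_fun u i.
Proof. by []. Qed.

Lemma single_linear I U (i : I) : linear (single i : U -> l2 I U).
Proof.
move=> a x y; apply: l2P => j.
rewrite -[RHS]/(a *: l2_fun (single i x) j + l2_fun (single i y) j) /=.
by case: eqP => //; rewrite scaler0 addr0.
Qed.

Lemma norm_single I U (i : I) (x : U) : `|single i x : l2 I U| = `|x|.
Proof.
apply/eqP; rewrite -(@eqrXn2 _ 2)//; apply/eqP.
by rewrite !sqr_normr_inner l2_inner_single single_eq.
Qed.

Lemma norm_single_le I U (i : I) (x : U) : `|single i x : l2 I U| <= 1 * `|x|.
Proof. by rewrite norm_single mul1r. Qed.

Definition singleop I U (i : I) : bop U (l2 I U) :=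
  mkbop (@single_linear I U i) (@norm_single_le I U i).

Lemma coord_linear I U (i : I) : linear (fun u : l2 I U => l2_fun u i).
Proof. by []. Qed.

Lemma coord_le I U (i : I) (u : l2 I U) : `|l2_fun u i| <= 1 * `|u|.
Proof. by rewrite mul1r; exact: l2_coord_le. Qed.

Definition coordop I U (i : I) : bop (l2 I U) U :=
  mkbop (@coord_linear I U i) (@coord_le I U i).

Lemma coordopE I U (i : I) (u : l2 I U) : coordop U i u = l2_fun u i.
Proof. by []. Qed.

Lemma singleopE I U (i : I) (x : U) : singleop U i x = single i x.
Proof. by []. Qed.

Lemma adj_singleop I U (i : I) : adj (singleop U i) = coordop U i.
Proof. by apply: adj_unique => x u; rewrite singleopE l2_inner_single. Qed.

Lemma adj_coordop I U (i : I) : adj (coordop U i) = singleop U i.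
Proof. by rewrite -adj_singleop adjK. Qed.

Lemma normb_singleop I U (i : I) : `|singleop U i| <= 1.
Proof. by apply: bop_normP => // x; exact: norm_single_le. Qed.

Lemma normb_coordop I U (i : I) : `|coordop U i| <= 1.
Proof. by apply: bop_normP => // x; exact: coord_le. Qed.

(** Instead of the density of the span of the elementary tensors, compare the
    adjoints, whose coordinates are the inner products with these tensors. *)
Lemma l2_bopP I U V (S T : bop (l2 I U) V) :
  (forall i x, S (single i x) = T (single i x)) -> S = T.
Proof.
move=> ST; apply: adj_inj; apply: bopP => y; apply: l2P => i.
by apply: inner_inj => x; rewrite -!l2_inner_single -!adjP ST.
Qed.

Lemma l2_bop2P I J U V (S T : bop (l2 I (l2 J U)) V) :
  (forall i j x, S (single i (single j x)) = T (single i (single j x))) -> S = T.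
Proof.
move=> ST; apply: l2_bopP => i x; rewrite -singleopE -!bcompE.
congr (bop_fun _ x); apply: l2_bopP => j y; exact: ST.
Qed.

Lemma diagop_ex I U V (T : I -> bop U V) (M : C) : (forall i, `|T i| <= M) ->
  exists D : bop (l2 I U) (l2 I V),
    `|D| <= `|M| /\ forall u i, l2_fun (D u) i = T i (l2_fun u i).
Proof.
move=> TM.
have Ti i x : `|T i x| <= `|M| * `|x|.
  apply: le_trans (bop_norm_le _ _) _; rewrite ler_wpM2r//.
  have M0 : 0 <= M := le_trans (normr_ge0 _) (TM i).
  by rewrite (ger0_norm M0).
have ps (u : l2 I U) K : partial_sum (fun i => `|T i (l2_fun u i)| ^+ 2) K <=
    (`|M| * `|u|) ^+ 2.
  rewrite exprMn; apply: le_trans (ler_wpM2l _ (l2_partial_le u K)); last first.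
    by rewrite exprn_ge0.
  rewrite /partial_sum mulr_sumr; apply: ler_sum => i _.
  by rewrite -exprMn ler_pXn2r ?nnegrE ?mulr_ge0.
have sub (u : l2 I U) : (fun i => T i (l2_fun u i)) \in @sqr_summable R I V.
  by apply/asboolP; exists ((`|M| * `|u|) ^+ 2) => K; exact: ps.
pose f u : l2 I V := L2Vec (sub u).
have fl : linear f.
  move=> a u v; apply: l2P => i.
  by rewrite -[RHS]/(a *: T i (l2_fun u i) + T i (l2_fun v i)) -bop_linear.
have fM u : `|f u| <= `|M| * `|u|.
  by apply: l2_norm_le; [rewrite mulr_ge0|exact: ps].
by exists (mkbop fl fM); split=> //; exact: bop_normP.
Qed.

(** The block diagonal operator with blocks [T i]; it exists when the blocks
    are uniformly bounded. *)
Definition diagop I U V (T : I -> bop U V) : bop (l2 I U) (l2 I V) :=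
  xget 0 [set D : bop (l2 I U) (l2 I V) |
    forall u i, l2_fun (D u) i = T i (l2_fun u i)].

Lemma diagop_eq I U V (T : I -> bop U V) (D : bop (l2 I U) (l2 I V)) :
  (forall u i, l2_fun (D u) i = T i (l2_fun u i)) -> diagop T = D.
Proof.
move=> DT; apply: xget_unique => // E ET; apply: bopP => u.
by apply: l2P => i; rewrite ET DT.
Qed.

Lemma diagopE I U V (T : I -> bop U V) (M : C) : (forall i, `|T i| <= M) ->
  forall u i, l2_fun (diagop T u) i = T i (l2_fun u i).
Proof.
by move=> /diagop_ex[D [_ DT]]; rewrite (diagop_eq DT).
Qed.

Lemma normb_diagop I U V (T : I -> bop U V) (M : C) : 0 <= M ->
  (forall i, `|T i| <= M) -> `|diagop T| <= M.
Proof.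
by move=> M0 /diagop_ex[D [DM DT]]; rewrite (diagop_eq DT) -(ger0_norm M0).
Qed.

Lemma diagop_single I U V (T : I -> bop U V) (M : C) : (forall i, `|T i| <= M) ->
  forall i x, diagop T (single i x) = single i (T i x).
Proof.
move=> TM i x; apply: l2P => j; rewrite (diagopE TM).
have [->|ji] := eqVneq j i; first by rewrite !single_eq.
by rewrite !single_neq// bop0.
Qed.

Lemma adj_diagop I U V (T : I -> bop U V) (M : C) : (forall i, `|T i| <= M) ->
  adj (diagop T) = diagop (fun i => adj (T i)).
Proof.
move=> TM; have aTM i : `|adj (T i)| <= M := le_trans (normb_adj _) (TM i).
apply: l2_bopP => i x; apply: l2P => j; apply: inner_inj => y.
rewrite -l2_inner_single -adjP (diagop_single TM) (diagop_single aTM).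
rewrite l2_inner_single; have [<-|ij] := eqVneq i j.
  by rewrite !single_eq adjP.
by rewrite !single_neq ?linear0r// eq_sym.
Qed.

Lemma diagop_ge0 I U (T : I -> bop U U) (M : C) : (forall i, `|T i| <= M) ->
  (forall i, op_ge0 (T i)) -> op_ge0 (diagop T).
Proof.
move=> TM T0 u.
apply: (@cvg_nneg _ totally _
  (partial_sum (fun i => inner (T i (l2_fun u i)) (l2_fun u i)))).
  have -> : partial_sum (fun i => inner (T i (l2_fun u i)) (l2_fun u i)) =
     partial_sum (fun i => inner (l2_fun (diagop T u) i) (l2_fun u i)).
    by congr partial_sum; apply/funext => i; rewrite (diagopE TM).
  exact: l2_inner_cvg.
by move=> J; apply: sumr_ge0 => i _; exact: T0.
Qed.

Lemma swap_sub I J U (u : l2 I (l2 J U)) (j : J) :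
  (fun i => l2_fun (l2_fun u i) j) \in @sqr_summable R I U.
Proof.
apply/asboolP; exists (`|u| ^+ 2) => K; apply: le_trans (l2_partial_le u K).
rewrite /partial_sum; apply: ler_sum => i _.
by rewrite ler_pXn2r ?nnegrE//; exact: l2_coord_le.
Qed.

Definition swap_row I J U (u : l2 I (l2 J U)) (j : J) : l2 I U :=
  L2Vec (swap_sub u j).

(** Interchange of the order of summation for a double series of
    nonnegative terms. *)
Lemma swap_row_le I J U (u : l2 I (l2 J U)) K :
  partial_sum (fun j => `|swap_row u j| ^+ 2) K <= `|u| ^+ 2.
Proof.
rewrite partial_sumE; apply: l2_sum_le => L.
under eq_bigr do rewrite partial_sumE; rewrite exchange_big /=.
apply: le_trans (l2_partial_le u L); rewrite partial_sumE.
apply: ler_sum => i _; apply: le_trans (l2_partial_le _ K).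
by rewrite partial_sumE.
Qed.

Lemma swap_row_sub I J U (u : l2 I (l2 J U)) :
  swap_row u \in @sqr_summable R J (l2 I U).
Proof. by apply/asboolP; exists (`|u| ^+ 2) => K; exact: swap_row_le. Qed.

Definition swap_vec I J U (u : l2 I (l2 J U)) : l2 J (l2 I U) :=
  L2Vec (swap_row_sub u).

Lemma swap_vec_linear I J U : linear (@swap_vec I J U).
Proof. by move=> a u v; apply: l2P => j; apply: l2P. Qed.

Lemma swap_vec_le I J U (u : l2 I (l2 J U)) : `|swap_vec u| <= 1 * `|u|.
Proof. by rewrite mul1r; apply: l2_norm_le => // K; exact: swap_row_le. Qed.

(** The exchange of the two factors in l_2(I) (x) l_2(J).  It is stated for two
    index sets because it serves both as [Fop] and as the identification of
    l_2(G, U)^n with l_2(G, U^n). *)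
Definition swapop I J U : bop (l2 I (l2 J U)) (l2 J (l2 I U)) :=
  mkbop (@swap_vec_linear I J U) (@swap_vec_le I J U).

Lemma swapopE I J U (u : l2 I (l2 J U)) j i :
  l2_fun (l2_fun (swapop I J U u) j) i = l2_fun (l2_fun u i) j.
Proof. by []. Qed.

Lemma normb_swapop I J U : `|swapop I J U| <= 1.
Proof. by apply: bop_normP => // u; exact: swap_vec_le. Qed.

Lemma single_single I J U i j (x : U) k l :
  l2_fun (l2_fun (single i (single j x : l2 J U) : l2 I (l2 J U)) k) l =
  if (k == i) && (l == j) then x else 0.
Proof. by rewrite /=; case: (k == i). Qed.

Lemma swapop_single I J U i j (x : U) :
  swapop I J U (single i (single j x)) = single j (single i x).
Proof.
apply: l2P => l; apply: l2P => k; rewrite swapopE.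
by rewrite !single_single andbC.
Qed.

Lemma adj_swapop I J U : adj (swapop I J U) = swapop J I U.
Proof.
apply: l2_bop2P => j i x; rewrite swapop_single; apply: l2P => k.
apply: l2P => l; apply: inner_inj => y.
rewrite -!l2_inner_single -adjP swapop_single !l2_inner_single.
by rewrite !single_single andbC.
Qed.

Lemma reindex_le I J U (s : J -> I) (u : l2 I U) K : injective s ->
  partial_sum (fun j => `|l2_fun u (s j)| ^+ 2) K <= `|u| ^+ 2.
Proof.
move=> sI; apply: le_trans (l2_partial_le u [fset s j | j in K]%fset).
rewrite !partial_sumE big_imfset//= => x y _ _; exact: sI.
Qed.

Lemma reindexop_ex I J U (s : J -> I) : injective s ->
  exists D : bop (l2 I U) (l2 J U), forall u j, l2_fun (D u) j = l2_fun u (s j).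
Proof.
move=> sI.
have sub (u : l2 I U) : (fun j => l2_fun u (s j)) \in @sqr_summable R J U.
  by apply/asboolP; exists (`|u| ^+ 2) => K; exact: (@reindex_le I J U s u K sI).
pose f u : l2 J U := L2Vec (sub u).
have fl : linear f by move=> a u v; apply: l2P.
have fM u : `|f u| <= 1 * `|u|.
  by rewrite mul1r; apply: l2_norm_le => // K; exact: (@reindex_le I J U s u K sI).
by exists (mkbop fl fM).
Qed.

Lemma mxop_ex U n (X : 'M[bop U U]_n) :
  exists T : bop (l2 'I_n U) (l2 'I_n U),
    forall u i, l2_fun (T u) i = \sum_j X i j (l2_fun u j).
Proof.
exists (\sum_j \sum_i singleop U i *o X i j *o coordop U j) => u k.
rewrite -(coordopE k) sumbE raddf_sum; apply: eq_bigr => j _.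
rewrite sumbE raddf_sum (bigD1 k)//= big1 ?addr0; first by rewrite eqxx.
by move=> i ik; rewrite eq_sym (negPf ik).
Qed.

Lemma sum_single U n (u : l2 'I_n U) :
  u = \sum_i (single i (l2_fun u i) : l2 'I_n U).
Proof.
apply: l2P => k; rewrite -[RHS](coordopE k) raddf_sum (bigD1 k)//= big1.
  by rewrite eqxx addr0.
by move=> i ik; rewrite eq_sym (negPf ik).
Qed.

Lemma mxopE U n (X : 'M[bop U U]_n) u i :
  l2_fun (mxop X u) i = \sum_j X i j (l2_fun u j).
Proof.
have [T TE] := mxop_ex X; suff -> : mxop X = T by [].
have TS j x : T (single j x) = \sum_i single i (X i j x).
  rewrite [LHS]sum_single; apply: eq_bigr => k _; congr single; rewrite TE.
  rewrite (bigD1 j)//= big1 ?addr0; first by rewrite eqxx.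
  by move=> l lj; rewrite (negPf lj) bop0.
by apply: xget_unique => // S SE; apply: l2_bopP => j x; rewrite SE TS.
Qed.

End l2_operators.

(** * Operator entries, the diagonal part and the blockwise product *)

Section schur_product.
Context (R : realType) (H : hilbertType (Cplx R)) (G : groupType).
Local Notation C := (Cplx R).
Local Notation HG := (l2 G H).
Local Notation K := (l2 G HG).
Implicit Types (X Y Z : bop HG HG).

Definition entry X (g h : G) : bop H H := coordop H g *o X *o singleop H h.

Lemma entryE X g h x : entry X g h x = l2_fun (X (single h x)) g.
Proof. by []. Qed.

Lemma entry_inj X Y : (forall g h, entry X g h = entry Y g h) -> X = Y.
Proof.
move=> XY; apply: l2_bopP => h x; apply: l2P => g.
by rewrite -!entryE XY.
Qed.

Lemma entryD X Y g h : entry (X + Y) g h = entry X g h + entry Y g h.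
Proof. by rewrite /entry bcompDr bcompDl. Qed.

Lemma entryZ a X g h : entry (a *: X) g h = a *: entry X g h.
Proof. by rewrite /entry bcompZr bcompZl. Qed.

Lemma entry0 (g h : G) : entry 0 g h = 0.
Proof. by apply: bopP => x. Qed.

Lemma entry_adj X g h : entry (adj X) g h = adj (entry X h g).
Proof. by rewrite /entry !adjM adj_singleop adj_coordop bcompA. Qed.

Lemma norm_entry X g h : `|entry X g h| <= `|X|.
Proof.
apply: le_trans (normb_comp _ _) _; rewrite -[leRHS]mulr1.
apply: ler_pM => //; last exact: normb_singleop.
apply: le_trans (normb_comp _ _) _; rewrite -[leRHS]mul1r.
by apply: ler_pM => //; exact: normb_coordop.
Qed.

Lemma LopE (k : G) (u : HG) g : l2_fun (Lop k u) g = l2_fun u (k^-1 * g)%g.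
Proof.
have [D DE] := reindexop_ex H (@mulgI G k^-1%g).
have DS xi h : D (single h xi) = single (k * h)%g xi.
  apply: l2P => g'; rewrite DE /= -(inj_eq (@mulgI G k)).
  by rewrite mulVKg.
suff -> : Lop k = D by rewrite DE.
apply: xget_unique => // S SE; apply: l2_bopP => h xi.
by rewrite SE DS.
Qed.

Lemma Lop_single (k h : G) (x : H) : Lop k (single h x) = single (k * h)%g x.
Proof.
by apply: l2P => g; rewrite LopE /= -(inj_eq (@mulgI G k)) mulVKg.
Qed.

Lemma entry_Lop k X g h : entry (Lop k *o X) g h = entry X (k^-1 * g)%g h.
Proof. by apply: bopP => x; rewrite !entryE bcompE LopE. Qed.

Lemma LopM (k l : G) : Lop k *o Lop l = Lop (k * l)%g :> bop HG HG.
Proof. by apply: l2_bopP => h x; rewrite bcompE !Lop_single mulgA. Qed.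

Lemma adj_Lop (k : G) : adj (Lop k) = Lop k^-1%g :> bop HG HG.
Proof.
apply: l2_bopP => h x; apply: l2P => g; apply: inner_inj => y.
rewrite -l2_inner_single -adjP !Lop_single l2_inner_single /=.
by rewrite -[g == _](inj_eq (@mulgI G k)) mulVKg.
Qed.

Lemma Lop1 : Lop (1%g : G) = idb HG.
Proof. by apply: l2_bopP => h x; rewrite Lop_single mul1g. Qed.

(** The three operators of the Stinespring representation are instances of
    general constructions: [rho X] and [Vop] are block diagonal, and [Fop] is a
    swap. *)
Lemma rho_diagop X : rho X = diagop (fun _ : G => X).
Proof.
apply: xget_unique => [g eta|S SE]; first by rewrite (@diagop_single _ _ _ _ _ `|X|).
by apply: l2_bopP => g eta; rewrite SE (@diagop_single _ _ _ _ _ `|X|).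
Qed.

Lemma rhoE X (u : K) g : l2_fun (rho X u) g = X (l2_fun u g).
Proof. by rewrite rho_diagop (@diagopE _ _ _ _ _ `|X|). Qed.

Lemma normb_rho X : `|rho X : bop K K| <= `|X|.
Proof. by rewrite rho_diagop; apply: normb_diagop. Qed.

Lemma adj_rho X : adj (rho X : bop K K) = rho (adj X).
Proof. by rewrite !rho_diagop (@adj_diagop _ _ _ _ _ `|X|). Qed.

Lemma rhoP a X Y : rho (a *: X + Y) = a *: rho X + rho Y :> bop K K.
Proof.
apply: bopP => u; apply: l2P => g; rewrite rhoE.
by rewrite !addbE !scalebE l2_funD l2_funZ !rhoE.
Qed.

Lemma Vop_diagop : Vop = diagop (@singleop R G H).
Proof.
have b1 := @normb_singleop R G H.
have VS g (x : H) : diagop (@singleop R G H) (single g x) = single g (single g x).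
  by rewrite (diagop_single b1).
apply: xget_unique => [x g|S SE]; first by rewrite VS.
by apply: l2_bopP => g x; rewrite SE VS.
Qed.

Lemma VopE (u : HG) g : l2_fun (Vop u) g = single g (l2_fun u g).
Proof. by rewrite Vop_diagop (diagopE (@normb_singleop R G H)). Qed.

Lemma adj_VopE (w : K) g : l2_fun (adj Vop w) g = l2_fun (l2_fun w g) g.
Proof.
rewrite Vop_diagop (adj_diagop (@normb_singleop R G H)).
rewrite (@diagopE _ _ _ _ _ 1) ?adj_singleop// => i.
by rewrite adj_singleop normb_coordop.
Qed.

Lemma normb_Vop : `|Vop : bop HG K| <= 1.
Proof. by rewrite Vop_diagop; apply: normb_diagop => // i; exact: normb_singleop. Qed.

Lemma normb_adj_Vop : `|adj Vop : bop K HG| <= 1.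
Proof. exact: le_trans (normb_adj _) normb_Vop. Qed.

Lemma Fop_swapop : Fop = swapop G G H.
Proof.
apply: xget_unique => [g x h|S SE]; first by rewrite swapop_single.
by apply: l2_bop2P => g h x; rewrite SE swapop_single.
Qed.

Lemma FopE (u : K) g h : l2_fun (l2_fun (Fop u) g) h = l2_fun (l2_fun u h) g.
Proof. by rewrite Fop_swapop. Qed.

Lemma adj_Fop : adj Fop = Fop :> bop K K.
Proof. by rewrite Fop_swapop adj_swapop. Qed.

Lemma normb_Fop : `|Fop : bop K K| <= 1.
Proof. by rewrite Fop_swapop; exact: normb_swapop. Qed.

Lemma FopK (u : K) : Fop (Fop u) = u.
Proof. by apply: l2P => g; apply: l2P => h; rewrite !FopE. Qed.

Definition diag_part X : bop HG HG := adj Vop *o rho X *o Vop.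

Lemma diag_partE X (u : HG) g :
  l2_fun (diag_part X u) g = entry X g g (l2_fun u g).
Proof. by rewrite !bcompE adj_VopE rhoE VopE. Qed.

Lemma entry_diag_part X g h :
  entry (diag_part X) g h = if g == h then entry X g g else 0.
Proof.
apply: bopP => x; rewrite entryE diag_partE.
have [->|gh] := eqVneq g h; first by rewrite single_eq.
by rewrite single_neq// bop0.
Qed.

Lemma diag_part_linear a X Y :
  diag_part (a *: X + Y) = a *: diag_part X + diag_part Y.
Proof. by rewrite /diag_part rhoP bcompDr bcompDl bcompZr bcompZl. Qed.

Lemma norm_diag_part X : `|diag_part X| <= `|X|.
Proof.
by apply: normb_comp3; [exact: normb_adj_Vop|exact: normb_rho|exact: normb_Vop].
Qed.

(** The Stinespring form of the expectation: pi(X^* X) is T^* T for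
    T = rho(X) V. *)
Lemma diag_part_adj_comp X :
  diag_part (adj X *o X) = adj (rho X *o Vop) *o (rho X *o Vop).
Proof.
rewrite adjM adj_rho /diag_part !bcompA; congr (_ *o _).
rewrite -!bcompA; congr (_ *o _).
by apply: bopP => u; apply: l2P => g; rewrite bcompE !rhoE.
Qed.

Lemma sqrt_diag_part X (u : HG) :
  `|op_sqrt (diag_part (adj X *o X)) u| = `|rho X (Vop u)|.
Proof.
by rewrite diag_part_adj_comp; have [_ _ _ ->] := op_sqrtP (rho X *o Vop).
Qed.

Lemma diag_part_faithful X : diag_part (adj X *o X) = 0 -> X = 0.
Proof.
rewrite diag_part_adj_comp => h; apply: l2_bopP => g x.
have h0 : rho X (Vop (single g x)) = 0.
  apply/eqP; rewrite -normr_eq0 -sqrf_eq0 -bcompE sqr_norm_adj h.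
  by rewrite zerobE linear0l.
have := congr1 (fun w : K => l2_fun w g) h0.
by rewrite rhoE VopE single_eq.
Qed.

Lemma starE X Y (u : HG) : star X Y u =
  adj Vop (rho X (Fop (rho Y (Vop u)))).
Proof. by []. Qed.

(** The vector rho(Y) V (xi (x) x_h) lives in the h-th copy of l_2(G, H).
    The flip [Fop] moves its inner coordinate Y_gh xi at g to the g-th copy,
    placed at h, where [X] acts on it. *)
Lemma entry_star X Y g h : entry (star X Y) g h = entry X g h *o entry Y g h.
Proof.
apply: bopP => x; rewrite bcompE !entryE starE adj_VopE rhoE.
congr (l2_fun (X _) _); apply: l2P => k; rewrite FopE rhoE VopE.
have [->|kh] := eqVneq k h; first by rewrite !single_eq.
rewrite (single_neq x kh) -(singleopE k) !bop0.
by rewrite single_neq.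
Qed.

End schur_product.

(** * Estimates for the blockwise product *)

Section schur_product_bounds.
Context (R : realType) (H : hilbertType (Cplx R)) (G : groupType).
Local Notation C := (Cplx R).
Local Notation HG := (l2 G H).
Local Notation K := (l2 G HG).
Implicit Types (X Y Z : bop HG HG).

Lemma star_linearl a X Y Z : star (a *: X + Y) Z = a *: star X Z + star Y Z.
Proof.
by rewrite /star rhoP bcompDr bcompZr !bcompDl !bcompZl.
Qed.

Lemma star_linearr a X Y Z : star X (a *: Y + Z) = a *: star X Y + star X Z.
Proof. by rewrite /star rhoP bcompDr bcompZr !bcompDl !bcompZl. Qed.

Lemma starA X Y Z : star (star X Y) Z = star X (star Y Z).
Proof. by apply: entry_inj => g h; rewrite !entry_star bcompA. Qed.

Lemma adj_star X Y : adj (star X Y) = star (adj Y) (adj X).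
Proof.
by apply: entry_inj => g h; rewrite entry_star !entry_adj entry_star adjM.
Qed.

(** The coordinate projection of l_2(G) (x) H (x) l_2(G) onto the pairs (h, g)
    that satisfy [P g h]. *)
Definition cut_op (P : G -> G -> bool) : bop K K :=
  diagop (fun h => diagop (fun g => (P g h)%:R *: idb H)).

Lemma norm_cut_scalar (P : G -> G -> bool) (g h : G) :
  `|(P g h)%:R *: idb H : bop H H| <= 1.
Proof.
by apply: bop_normP => // x; rewrite scalebE normrZ normr_nat ler_wpM2r//; case: (P g h).
Qed.

Lemma cut_opE P (u : K) h g :
  l2_fun (l2_fun (cut_op P u) h) g = (P g h)%:R *: l2_fun (l2_fun u h) g.
Proof.
rewrite /cut_op (@diagopE _ _ _ _ _ 1) ?(@diagopE _ _ _ _ _ 1)// => i.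
  by exact: norm_cut_scalar.
by apply: normb_diagop => // j; exact: norm_cut_scalar.
Qed.

Lemma normb_cut_op P : `|cut_op P| <= 1.
Proof.
apply: normb_diagop => // h; apply: normb_diagop => // g; exact: norm_cut_scalar.
Qed.

(** The blockwise product restricted to the entries selected by [P].  The
    projection sits next to [Fop] inside the Stinespring formula, so that the
    truncation costs nothing in norm. *)
Definition cut_star P X Y : bop HG HG :=
  adj Vop *o (rho X *o Fop *o cut_op P *o rho Y) *o Vop.

Lemma entry_cut_star P X Y g h :
  entry (cut_star P X Y) g h = (P g h)%:R *: (entry X g h *o entry Y g h).
Proof.
apply: bopP => x; rewrite scalebE [in RHS]bcompE !entryE !bcompE adj_VopE rhoE.
rewrite -[RHS]/(l2_fun ((P g h)%:R *: X (single h (l2_fun (Y (single h x)) g))) g).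
rewrite -bopZ.
congr (l2_fun (X _) _); apply: l2P => k; rewrite FopE cut_opE rhoE VopE.
rewrite -[RHS]/((P g h)%:R *: l2_fun (single h (l2_fun (Y (single h x)) g)) k).
have [->|kh] := eqVneq k h; first by rewrite !single_eq.
rewrite (single_neq x kh) -(singleopE k) !bop0 single_neq//.
by rewrite !scaler0.
Qed.

Lemma normb_cut_star P X Y : `|cut_star P X Y| <= `|X| * `|Y|.
Proof.
apply: normb_comp3; [exact: normb_adj_Vop| |exact: normb_Vop].
apply: le_trans (normb_comp _ _) _; apply: ler_pM => //; last exact: normb_rho.
rewrite -[rho X]/(rho X) -bcompA; apply: le_trans (normb_comp _ _) _.
rewrite -[leRHS]mulr1; apply: ler_pM => //; first exact: normb_rho.
apply: le_trans (normb_comp _ _) _; rewrite -[leRHS]mulr1.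
by apply: ler_pM => //; [exact: normb_Fop|exact: normb_cut_op].
Qed.

Lemma star_cut X Y : star X Y = cut_star (fun _ _ => true) X Y.
Proof.
by apply: entry_inj => g h; rewrite entry_star entry_cut_star scale1r.
Qed.

Lemma normb_star X Y : `|star X Y| <= `|X| * `|Y|.
Proof. by rewrite star_cut normb_cut_star. Qed.

Lemma cut_star_linearl P a X Y Z :
  cut_star P (a *: X + Y) Z = a *: cut_star P X Z + cut_star P Y Z.
Proof.
by rewrite /cut_star rhoP !(bcompDl, bcompZl) bcompDr bcompZr bcompDl bcompZl.
Qed.

(** The operator L_k pi(L_k^* X) keeps the entries of [X] on the k-th diagonal
    {(k h, h)}, and the diagonal part of L_k^* Y multiplies them by those of
    [Y] on the same diagonal. *)
Lemma Lop_diag_part_cut_star X Y (k : G) :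
  Lop k *o diag_part (adj (Lop k) *o X) *o diag_part (adj (Lop k) *o Y) =
  cut_star (fun g h => g == (k * h)%g) X Y.
Proof.
apply: entry_inj => g h; rewrite entry_cut_star; apply: bopP => x.
rewrite entryE bcompE -!bcompA.
rewrite LopE bcompE diag_partE diag_partE adj_Lop !entry_Lop invgK mulVKg.
rewrite scalebE -(inj_eq (@mulgI G k^-1%g)) mulKg.
have [<-|gh] := eqVneq (k^-1 * g)%g h.
  by rewrite scale1r single_eq.
by rewrite scale0r single_neq// !bop0.
Qed.

(** Each pair (g, h) lies on exactly one diagonal, the one of index
    g h^-1. *)
Lemma partial_sum_cut_star X Y (J : {fset G}) :
  partial_sum (fun k => Lop k *o diag_part (adj (Lop k) *o X) *o
    diag_part (adj (Lop k) *o Y)) J =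
  cut_star (fun g h => (g * h^-1)%g \in J) X Y.
Proof.
rewrite partial_sumE; apply: entry_inj => g h.
have -> : entry (\sum_(k <- J) (Lop k *o diag_part (adj (Lop k) *o X) *o
    diag_part (adj (Lop k) *o Y))) g h =
    \sum_(k <- J) (g == (k * h)%g)%:R *: (entry X g h *o entry Y g h).
  elim/big_rec2: _ => [|k T S _ <-]; first exact: entry0.
  by rewrite entryD Lop_diag_part_cut_star entry_cut_star.
rewrite entry_cut_star -scaler_suml; congr (_ *: _).
case: (boolP (_ \in J)) => gJ.
  rewrite (big_fsetD1 _ gJ) /= mulgVK eqxx big_seq_cond big1 ?addr0// => k.
  rewrite !inE => /andP[/andP[kg _] _]; case: eqP => // gE.
  by rewrite gE mulgK eqxx in kg.
rewrite big_seq_cond big1// => k /andP[kJ _]; case: eqP => // gE.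
by rewrite gE mulgK kJ in gJ.
Qed.

Lemma diag_part_Lop_star X Y k :
  diag_part (adj (Lop k) *o star X Y) =
  diag_part (adj (Lop k) *o X) *o diag_part (adj (Lop k) *o Y).
Proof.
apply: bopP => u; apply: l2P => g; rewrite bcompE !diag_partE.
by rewrite !adj_Lop !entry_Lop invgK entry_star bcompE.
Qed.

Lemma inner_star X Y (xi gamma : HG) :
  inner (star X Y xi) gamma =
  inner (Fop (rho Y (Vop xi))) (rho (adj X) (Vop gamma)).
Proof. by rewrite starE adjPl -adj_rho -adjP. Qed.

Lemma star_schwarz X Y (xi gamma : HG) :
  `|inner (star X Y xi) gamma| <=
  `|op_sqrt (diag_part (X *o adj X)) gamma| *
  `|op_sqrt (diag_part (adj Y *o Y)) xi|.
Proof.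
have -> : X *o adj X = adj (adj X) *o adj X by rewrite adjK.
rewrite inner_star !sqrt_diag_part mulrC.
apply: le_trans (inner_cs _ _) _; rewrite ler_wpM2r//.
apply: le_trans (bop_norm_le _ _) _; rewrite -[leRHS]mul1r ler_wpM2r//.
exact: normb_Fop.
Qed.

Lemma adj_sqrt_diag_part X :
  adj (op_sqrt (diag_part (adj X *o X))) = op_sqrt (diag_part (adj X *o X)).
Proof.
by rewrite diag_part_adj_comp; have [_ _ ->] := op_sqrtP (rho X *o Vop).
Qed.

(** Douglas factorization on both sides of X * Y = T_Z^* F T_Y, where
    Z = X^* and T_Y = rho(Y) V: both T_Y and T_Z are a contraction times a
    square root of a diagonal part. *)
Lemma star_factor X Y : exists S : bop HG HG, `|S| <= 1 /\
  star X Y = op_sqrt (diag_part (X *o adj X)) *o S *o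
    op_sqrt (diag_part (adj Y *o Y)).
Proof.
have -> : X *o adj X = adj (adj X) *o adj X by rewrite adjK.
have fac Z : exists S : bop HG K, `|S| <= 1 /\
    rho Z *o Vop = S *o op_sqrt (diag_part (adj Z *o Z)).
  by apply: douglas_factor => u; rewrite sqrt_diag_part.
have [S1 [S1n S1E]] := fac Y; have [S2 [S2n S2E]] := fac (adj X).
exists (adj S2 *o Fop *o S1); split.
  apply: normb_comp3 => //; first exact: le_trans (normb_adj _) S2n.
  exact: normb_Fop.
have -> : star X Y = adj (rho (adj X) *o Vop) *o Fop *o (rho Y *o Vop).
  by rewrite adjM -adj_rho adjK /star !bcompA.
by rewrite S1E S2E adjM adj_sqrt_diag_part !bcompA.
Qed.

(** With w = rho(X) V u, the two differences are half the squared norms of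
    F w + w and F w - w. *)
Lemma star_adj_le X : op_le (- diag_part (adj X *o X)) (star (adj X) X) /\
  op_le (star (adj X) X) (diag_part (adj X *o X)).
Proof.
have dE (u : HG) : inner (diag_part (adj X *o X) u) u =
    inner (rho X (Vop u)) (rho X (Vop u)).
  by rewrite diag_part_adj_comp -sqr_norm_adj sqr_normr_inner.
have FE (w : K) : inner (Fop w) (Fop w) = inner w w.
  by rewrite -{1}adj_Fop adjPl FopK.
have Fs (w : K) : inner w (Fop w) = inner (Fop w) w by rewrite -{1}adj_Fop -adjP.
have n2 : 0 <= 2%:R^-1 :> C by rewrite invr_ge0.
have n2' : 2%:R != 0 :> C by rewrite pnatr_eq0.
split=> u; rewrite bopE oppbE ?oppbE innerBl ?innerNl inner_star adjK dE;
  set w := rho X _.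
- have -> : inner (Fop w) w - - inner w w = 2%:R^-1 * inner (Fop w + w) (Fop w + w).
    rewrite !innerDl !innerDr FE Fs.
    by move: (inner (Fop w) w) (inner w w) => p q; field.
  by rewrite mulr_ge0// inner_ge0.
- have -> : inner w w - inner (Fop w) w = 2%:R^-1 * inner (Fop w - w) (Fop w - w).
    rewrite !innerBl !innerBr FE Fs.
    by move: (inner (Fop w) w) (inner w w) => p q; field.
  by rewrite mulr_ge0// inner_ge0.
Qed.

Definition const_diag (U W : hilbertType C) n (T : bop U W) :
  bop (l2 'I_n U) (l2 'I_n W) := diagop (fun _ => T).

Lemma const_diagE (U W : hilbertType C) n (T : bop U W) (u : l2 'I_n U) i :
  l2_fun (const_diag n T u) i = T (l2_fun u i).
Proof. by rewrite /const_diag (@diagopE _ _ _ _ _ `|T|). Qed.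

Lemma normb_const_diag (U W : hilbertType C) n (T : bop U W) : `|const_diag n T| <= `|T|.
Proof. exact: normb_diagop. Qed.

Lemma adj_const_diag (U W : hilbertType C) n (T : bop U W) :
  adj (const_diag n T) = const_diag n (adj T).
Proof. exact: (@adj_diagop _ _ _ _ _ `|T|). Qed.

(** The matrix (rho(X_ij)) acting on l_2(G, l_2(G, H))^n is, after exchanging
    the outer l_2(G) with the n coordinates, a direct sum of copies of
    [mxop X]; norm bounds and positivity are inherited from [mxop X]. *)
Definition mxrho n (X : 'M[bop HG HG]_n) : bop (l2 'I_n K) (l2 'I_n K) :=
  swapop G 'I_n HG *o diagop (fun _ : G => mxop X) *o swapop 'I_n G HG.

Lemma mxrhoE n (X : 'M[bop HG HG]_n) w i :
  l2_fun (mxrho X w) i = \sum_j rho (X i j) (l2_fun w j).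
Proof.
apply: l2P => g; rewrite /mxrho 2!bcompE swapopE.
rewrite (@diagopE _ _ _ _ _ `|mxop X|)// mxopE -[RHS](coordopE g) bop_sum.
by apply: eq_bigr => j _; rewrite coordopE rhoE.
Qed.

Lemma normb_mxrho n (X : 'M[bop HG HG]_n) : `|mxrho X| <= `|mxop X|.
Proof.
by apply: normb_comp3; [exact: normb_swapop|exact: normb_diagop|exact: normb_swapop].
Qed.

(** The Stinespring formula for operator matrices, with V and F applied
    coordinatewise. *)
Lemma mxop_star n (X Y : 'M[bop HG HG]_n) :
  mxop (amplification_mx star X Y) =
  const_diag n (adj Vop) *o (mxrho X *o const_diag n Fop *o mxrho Y) *o
    const_diag n Vop.
Proof.
apply: bopP => u; apply: l2P => i; rewrite mxopE !bcompE const_diagE mxrhoE bop_sum.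
transitivity (\sum_j \sum_k star (X i k) (Y k j) (l2_fun u j)).
  by apply: eq_bigr => j _; rewrite mxE sumbE.
rewrite exchange_big; apply: eq_bigr => k _.
rewrite const_diagE mxrhoE; under [in RHS]eq_bigr do rewrite const_diagE.
by rewrite !bop_sum.
Qed.

Lemma star_completely_contractive n (X Y : 'M[bop HG HG]_n) :
  `|mxop (amplification_mx star X Y)| <= `|mxop X| * `|mxop Y|.
Proof.
rewrite mxop_star; apply: normb_comp3.
- exact: le_trans (normb_const_diag _ _) (normb_adj_Vop _ _).
- apply: le_trans (normb_comp _ _) _; apply: ler_pM => //;
    last exact: normb_mxrho.
  apply: le_trans (normb_comp _ _) _; rewrite -[leRHS]mulr1.
  apply: ler_pM => //; first exact: normb_mxrho.
  exact: le_trans (normb_const_diag _ _) (normb_Fop _ _).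
- exact: le_trans (normb_const_diag _ _) (normb_Vop _ _).
Qed.

Lemma mxop_diag_part n (X : 'M[bop HG HG]_n) :
  mxop (map_mx (@diag_part R H G) X) =
  adj (const_diag n Vop) *o mxrho X *o const_diag n Vop.
Proof.
apply: bopP => u; apply: l2P => i.
rewrite mxopE !bcompE adj_const_diag const_diagE mxrhoE bop_sum.
by apply: eq_bigr => j _; rewrite mxE const_diagE.
Qed.

Lemma diag_part_cp (D : set (bop HG HG)) : completely_positive D (@diag_part R H G).
Proof.
move=> n X _ X0 u; rewrite mxop_diag_part bcompE bcompE adjPl.
set w := const_diag n Vop u.
rewrite /mxrho 2!bcompE -(adj_swapop 'I_n G) adjPl.
exact: (@diagop_ge0 _ _ _ _ `|mxop X|).
Qed.

End schur_product_bounds.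

(** * The reduced crossed product *)

Section crossed_product_theory.
Context (R : realType) (H : hilbertType (Cplx R)) (G : groupType).
Local Notation C := (Cplx R).
Local Notation HG := (l2 G H).
Context (A : set (bop H H)) (alpha : G -> bop H H -> bop H H).
Context (Acs : is_cstar_algebra A) (act : is_action A alpha).
Local Notation Psi := (Psi alpha).
Local Notation D := (crossed_product A alpha).

(** For |b| <= 1 the algebra contains a self-adjoint [c] with
    b^* b = 2 c - c^2.  Applying [f], which respects this algebraic relation,
    gives 1 - f(b)^* f(b) = (1 - f(c))^2 >= 0, that is |f(b)| <= 1. *)
Lemma automorphism_contractive (B : set (bop H H)) (f : bop H H -> bop H H) a :
  is_cstar_algebra B -> is_star_automorphism B f -> B a -> `|f a| <= `|a|.
Proof.
move=> Bcs faut Ba.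
suff unit_case b : B b -> `|b| <= 1 -> `|f b| <= 1.
  have [a0|a0] := eqVneq `|a| 0.
    have -> : a = 0 *: a by rewrite scale0r; apply/eqP; rewrite -normr_eq0 a0.
    by rewrite (automorphismZ faut)// !scale0r normr0.
  have na : 0 < `|a| by rewrite normr_gt0 -normr_eq0.
  have := unit_case (`|a|^-1 *: a) (cstarZ Bcs _ Ba).
  rewrite (automorphismZ faut)// !normrZ normfV normr_id mulVf// => /(_ (lexx _)).
  by rewrite ler_pdivrMl// mulr1.
move=> {a Ba} Bb b1.
have T1 : `|adj b *o b| <= 1.
  apply: le_trans (normb_comp _ _) _; rewrite -[leRHS]mulr1.
  by apply: ler_pM => //; exact: le_trans (normb_adj _) b1.
have BT : B (adj b *o b) by apply: cstarM => //; exact: cstar_adj.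
have [|||c [[Bc cself] _ cE]] := @quadratic_root R H _ (B `&` [set T | adj T = T]) T1.
- split; first exact: cstar0.
  by apply: adj_unique => x y; rewrite !zerobE linear0l linear0r.
- move=> X [BX Xs]; split.
    by apply: cstarZ => //; apply: cstarD => //; exact: cstarM.
  by rewrite /= adjZ adjD !adjM adjK Xs conj_Creal// realV realn.
- apply: norm_closedI; last exact: norm_closed_selfadj.
  exact: closed_norm_closed (cstar_closed Bcs).
have fcself : adj (f c) = f c by rewrite -(automorphism_adj faut)// cself.
have fE : adj (f b) *o f b + f c *o f c = 2%:R *: f c.
  have Bb' : B (adj b) by exact: cstar_adj.
  have Bcc : B (c *o c) by exact: cstarM.
  rewrite -(automorphism_adj faut)// -!(automorphismM faut)//.
  by rewrite -(automorphismD faut)// cE (automorphismZ faut).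
apply: bop_normP => // x; rewrite mul1r -(@ler_pXn2r _ 2) ?nnegrE//.
rewrite sqr_norm_adj -subr_ge0.
have -> : adj (f b) *o f b = 2%:R *: f c - f c *o f c by rewrite -fE addrK.
have := inner_ge0 (x - f c x).
rewrite innerBl !innerBr -!sqr_normr_inner => h; apply: le_trans h _.
rewrite addbE oppbE scalebE bcompE innerBl innerZl.
have -> : inner (f c (f c x)) x = `|f c x| ^+ 2.
  by rewrite -{1}fcself adjPl -sqr_normr_inner.
have -> : inner x (f c x) = inner (f c x) x by rewrite -[LHS]adjPl fcself.
by rewrite le_eqVlt; apply/orP; left; apply/eqP; ring.
Qed.

Lemma alpha_mem g a : A a -> A (alpha g a).
Proof. by case: (automorphism_bij (action_automorphism act g)) => h _ _ /h. Qed.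

Lemma alpha_contractive g a : A a -> `|alpha g a| <= `|a|.
Proof. by move=> Aa; exact: automorphism_contractive (action_automorphism act g) Aa. Qed.

(** An action by bijections: alpha_1 is idempotent and injective. *)
Lemma alpha1 a : A a -> alpha 1%g a = a.
Proof.
move=> Aa; have [_ inj _] := automorphism_bij (action_automorphism act 1%g).
apply: inj; rewrite ?inE//; first exact: alpha_mem.
by rewrite -(actionM act)// mulg1.
Qed.

Lemma alpha_linear g c a b : A a -> A b ->
  alpha g (c *: a + b) = c *: alpha g a + alpha g b.
Proof.
move=> Aa Ab; have aut := action_automorphism act g.
by rewrite (automorphismD aut)// ?(automorphismZ aut)//; exact: cstarZ.
Qed.

Lemma cstar_linear c a b : A a -> A b -> A (c *: a + b).
Proof. by move=> Aa Ab; apply: cstarD => //; exact: cstarZ. Qed.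

Lemma Psi_diagop a : A a -> Psi a = diagop (fun h => alpha h^-1%g a).
Proof.
move=> Aa; have b h := alpha_contractive h^-1%g Aa.
apply: xget_unique => [x h|S SE]; first by rewrite (diagop_single b).
by apply: l2_bopP => h x; rewrite SE (diagop_single b).
Qed.

Lemma PsiE a (u : HG) h : A a ->
  l2_fun (Psi a u) h = alpha h^-1%g a (l2_fun u h).
Proof.
move=> Aa; rewrite Psi_diagop// (@diagopE _ _ _ _ _ `|a|)// => k.
exact: alpha_contractive.
Qed.

Lemma norm_Psi a : A a -> `|Psi a| <= `|a|.
Proof.
move=> Aa; rewrite Psi_diagop//; apply: normb_diagop => // k.
exact: alpha_contractive.
Qed.

Lemma Psi_single a h (x : H) : A a ->
  Psi a (single h x) = single h (alpha h^-1%g a x).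
Proof.
move=> Aa; rewrite Psi_diagop// (@diagop_single _ _ _ _ _ `|a|)// => k.
exact: alpha_contractive.
Qed.

Lemma entry_PsiX a X g h : A a ->
  entry (Psi a *o X) g h = alpha g^-1%g a *o entry X g h.
Proof. by move=> Aa; apply: bopP => x; rewrite entryE bcompE PsiE. Qed.

Lemma entry_XPsi a X g h : A a ->
  entry (X *o Psi a) g h = entry X g h *o alpha h^-1%g a.
Proof. by move=> Aa; apply: bopP => x; rewrite entryE bcompE Psi_single. Qed.

Lemma entry_Psi a g h : A a ->
  entry (Psi a) g h = if g == h then alpha g^-1%g a else 0.
Proof.
move=> Aa; apply: bopP => x; rewrite entryE PsiE//.
have [->|gh] := eqVneq g h; first by rewrite single_eq.
by rewrite single_neq// bop0.
Qed.

(** The entry of Psi(a) at the unit of the group is [a]. *)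
Lemma norm_le_Psi a : A a -> `|a| <= `|Psi a|.
Proof.
move=> Aa; apply: le_trans (norm_entry _ 1%g 1%g).
by rewrite entry_Psi// eqxx invg1 alpha1.
Qed.

Lemma Psi_linear c a b : A a -> A b -> Psi (c *: a + b) = c *: Psi a + Psi b.
Proof.
move=> Aa Ab; have Aab := cstar_linear c Aa Ab.
apply: entry_inj => g h; rewrite entryD entryZ !entry_Psi//.
by case: ifP => _; rewrite ?alpha_linear// scaler0 addr0.
Qed.

Lemma Psi0 : Psi 0 = 0.
Proof.
have A0 : A 0 by exact: cstar0.
have := Psi_linear 1 A0 A0; rewrite !scale1r addr0 => h.
by apply: (addrI (Psi 0)); rewrite -h addr0.
Qed.

Lemma PsiZ c a : A a -> Psi (c *: a) = c *: Psi a.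
Proof.
move=> Aa; have A0 : A 0 by exact: cstar0.
by have := Psi_linear c Aa A0; rewrite !addr0 Psi0 addr0.
Qed.

Lemma PsiM a b : A a -> A b -> Psi (a *o b) = Psi a *o Psi b.
Proof.
move=> Aa Ab; have Aab : A (a *o b) by exact: cstarM.
apply: entry_inj => g h; rewrite entry_PsiX// !entry_Psi//.
case: ifP => _; first by rewrite (automorphismM (action_automorphism act _)).
by rewrite bcomp0r.
Qed.

Lemma adj_Psi a : A a -> adj (Psi a) = Psi (adj a).
Proof.
move=> Aa; have Aa' : A (adj a) by exact: cstar_adj.
apply: entry_inj => g h; rewrite entry_adj !entry_Psi// eq_sym.
have [->|_] := eqVneq g h.
  by rewrite (automorphism_adj (action_automorphism act _)).
by apply: adj_unique => x y; rewrite !zerobE linear0l linear0r.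
Qed.

Lemma Psi_Lop a k : A a -> Psi a *o Lop k = Lop k *o Psi (alpha k^-1%g a).
Proof.
move=> Aa; have Aa' := alpha_mem k^-1%g Aa.
apply: l2_bopP => h x; rewrite !bcompE Lop_single !Psi_single// Lop_single.
by rewrite -(actionM act)// invgM.
Qed.

Lemma linear_span_linear (W : lmodType C) (S : set W) c x y :
  linear_span S x -> linear_span S y -> linear_span S (c *: x + y).
Proof.
move=> [n [a [v [Sv ->]]]] [m [b [w [Sw ->]]]].
exists (n + m)%N,
  (fun i => match fintype.split i with inl j => c * a j | inr j => b j end),
  (fun i => match fintype.split i with inl j => v j | inr j => w j end); split.
  by move=> i; case: (fintype.split i).
rewrite big_split_ord /=; congr (_ + _).
  rewrite scaler_sumr; apply: eq_bigr => i _.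
  by rewrite -[lshift _ _]/(unsplit (inl i)) unsplitK scalerA.
by apply: eq_bigr => i _; rewrite -[rshift _ _]/(unsplit (inr i)) unsplitK.
Qed.

Lemma crossed_product_closed : norm_closed D.
Proof. apply: closed_norm_closed; exact: closed_closure. Qed.

Lemma crossed_product_gen g a : A a -> D (Lop g *o Psi a).
Proof.
move=> Aa; apply: subset_closure; exists 1%N, (fun=> 1), (fun=> Lop g *o Psi a).
split; last by rewrite big_ord1 scale1r.
by move=> _; exists g, a.
Qed.

Lemma crossed_product_linear c X Y : D X -> D Y -> D (c *: X + Y).
Proof.
move=> /closureE_norm dX /closureE_norm dY; apply/closureE_norm => e e0.
have c1 : 0 < `|c| + 1 by rewrite ltr_wpDl.
have e2 : 0 < e / (`|c| + 1) by rewrite divr_gt0.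
have [X' sX XX] := dX _ e2; have [Y' sY YY] := dY _ e2.
exists (c *: X' + Y'); first exact: linear_span_linear.
have -> : c *: X + Y - (c *: X' + Y') = c *: (X - X') + (Y - Y').
  by rewrite scalerBr opprD addrACA.
apply: le_lt_trans (ler_normD _ _) _; rewrite normrZ.
have -> : e = `|c| * (e / (`|c| + 1)) + e / (`|c| + 1) by field; rewrite gt_eqF.
by apply: ler_ltD => //; rewrite ler_wpM2l// ltW.
Qed.

(** Linear, norm-closed properties pass from the generators to their closed
    span; the facts about the crossed product below are obtained this way. *)
Lemma crossed_product_ind (P : set (bop HG HG)) :
  P 0 -> (forall c X Y, P X -> P Y -> P (c *: X + Y)) -> norm_closed P ->
  (forall g a, A a -> P (Lop g *o Psi a)) -> D `<=` P.
Proof.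
move=> P0 Pl Pc Pg X /closureE_norm dX; apply: Pc => e /dX[Y sY XY].
exists Y => //; case: sY => n [c [v [Sv ->]]].
elim/big_ind: _ => //.
  by move=> x y Px Py; rewrite -[x]scale1r; exact: Pl.
move=> i _; rewrite -[_ *: _]addr0; apply: Pl => //.
by have [g [a Aa ->]] := Sv i; exact: Pg.
Qed.

Lemma crossed_product0 : D 0.
Proof.
apply: subset_closure; exists 0%N, (fun=> 0), (fun=> 0).
by split; [case|rewrite big_ord0].
Qed.

Lemma crossed_product_Psi a : A a -> D (Psi a).
Proof.
move=> Aa; suff -> : Psi a = Lop 1%g *o Psi a by exact: crossed_product_gen.
by rewrite Lop1; exact: bopP.
Qed.

(** By the induction principle in each variable, this reduces to the
    covariance relation, which rewrites a product of two generators as a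
    generator. *)
Lemma crossed_productM X Y : D X -> D Y -> D (X *o Y).
Proof.
move=> dX dY; apply: (crossed_product_ind (P := fun X => D (X *o Y))) dX.
- by rewrite bcomp0l; exact: crossed_product0.
- by move=> c S T dS dT; rewrite bcompDl bcompZl; exact: crossed_product_linear.
- apply: (@norm_closed_preimage _ _ _ (fun X => X *o Y) _ `|Y|) => //;
    last exact: crossed_product_closed.
  by move=> S T; rewrite -bcompBl mulrC normb_comp.
move=> g a Aa; apply: (crossed_product_ind (P := fun Y => D (Lop g *o Psi a *o Y))) dY.
- by rewrite bcomp0r; exact: crossed_product0.
- by move=> c S T dS dT; rewrite bcompDr bcompZr; exact: crossed_product_linear.
- apply: (@norm_closed_preimage _ _ _ (fun Y => Lop g *o Psi a *o Y) _ `|Lop g *o Psi a|) => //;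
    last exact: crossed_product_closed.
  by move=> S T; rewrite -bcompBr normb_comp.
move=> k b Ab; rewrite -bcompA [Psi a *o _]bcompA Psi_Lop//
  !bcompA LopM -bcompA -PsiM//;
  last exact: alpha_mem.
by apply: crossed_product_gen; apply: cstarM => //; exact: alpha_mem.
Qed.

Lemma crossed_product_adj X : D X -> D (adj X).
Proof.
apply: (crossed_product_ind (P := fun X => D (adj X))).
- have -> : adj (0 : bop HG HG) = 0.
    by apply: adj_unique => x y; rewrite !zerobE linear0l linear0r.
  exact: crossed_product0.
- by move=> c S T dS dT; rewrite adjD adjZ; exact: crossed_product_linear.
- apply: (@norm_closed_preimage _ _ _ (@adj R HG HG) _ 1) => //;
    last exact: crossed_product_closed.
  by move=> S T; rewrite -adjB mul1r normb_adj.
move=> g a Aa; have Aa' : A (adj a) by exact: cstar_adj.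
rewrite adjM adj_Psi// adj_Lop Psi_Lop//; apply: crossed_product_gen.
exact: alpha_mem.
Qed.

Lemma crossed_product_Lop g X : D X -> D (Lop g *o X).
Proof.
apply: (crossed_product_ind (P := fun X => D (Lop g *o X))).
- by rewrite bcomp0r; exact: crossed_product0.
- by move=> c S T dS dT; rewrite bcompDr bcompZr; exact: crossed_product_linear.
- apply: (@norm_closed_preimage _ _ _ (fun Y => Lop g *o Y) _ `|Lop g : bop HG HG|) => //;
    last exact: crossed_product_closed.
  by move=> S T; rewrite -bcompBr normb_comp.
by move=> k a Aa; rewrite bcompA LopM; exact: crossed_product_gen.
Qed.

(** [Psi] is isometric and the algebra is complete, so preimages of a Cauchy
    sequence converge. *)
Lemma Psi_image_closed : norm_closed (Psi @` A).
Proof.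
move=> T h.
have ex n : exists a, A a /\ `|T - Psi a| < (n.+1%:R)^-1 :> C.
  have [|_ [a Aa <-] Ta] := h (n.+1%:R)^-1; first by rewrite invr_gt0.
  by exists a.
have [a aP] := choice ex.
have Aa n : A (a n) by case: (aP n).
have Ta n : `|T - Psi (a n)| < (n.+1%:R)^-1 by case: (aP n).
have PsiB b c : A b -> A c -> Psi (b - c) = Psi b - Psi c.
  by move=> Ab Ac; rewrite addrC -scaleN1r Psi_linear// scaleN1r addrC.
have AB b c : A b -> A c -> A (b - c).
  by move=> Ab Ac; rewrite addrC -scaleN1r; exact: cstar_linear.
have [|b ab] := @bop_cauchy_cvg R H H a.
  move=> e e0; have e2 : 0 < e / 2%:R by rewrite divr_gt0.
  have [N NP] := invn_lt_eps e2; exists N => m n mN nN.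
  apply: le_lt_trans (norm_le_Psi (AB _ _ (Aa m) (Aa n))) _; rewrite PsiB//.
  have -> : Psi (a m) - Psi (a n) = (T - Psi (a n)) - (T - Psi (a m)).
    by rewrite opprB addrCA addrAC subrr add0r.
  apply: le_lt_trans (ler_normB _ _) _.
  have -> : e = e / 2%:R + e / 2%:R by field.
  by apply: ltrD; [apply: lt_trans (Ta n) (NP _ nN)|apply: lt_trans (Ta m) (NP _ mN)].
have Ab : A b.
  apply: (closed_norm_closed (cstar_closed Acs)) => e /ab[N NP].
  by exists (a N) => //; exact: NP.
exists b => //; apply/eqP; rewrite eq_sym -subr_eq0 -normr_le0.
apply: (@le_of_le_eps _ _ _ 2%:R) => // e e0; rewrite add0r.
have [N1 h1] := ab e e0; have [N2 h2] := invn_lt_eps e0.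
pose n := maxn N1 N2; rewrite -(subrKA (Psi (a n))) mulr_natl mulr2n.
apply: le_trans (ler_normD _ _) _; apply: lerD.
  by apply/ltW/(lt_trans (Ta n))/h2; exact: leq_maxr.
rewrite -PsiB//; apply: le_trans (norm_Psi (AB _ _ (Aa n) Ab)) _.
by rewrite distrC; apply/ltW/h1; exact: leq_maxl.
Qed.

Lemma diag_part_gen g a : A a ->
  diag_part (Lop g *o Psi a) = (g == 1%g)%:R *: Psi a.
Proof.
move=> Aa; apply: entry_inj => h k; rewrite entry_diag_part entryZ entry_Lop.
rewrite !entry_Psi//; have [->|_] := eqVneq h k; last by rewrite scaler0.
rewrite -(inj_eq (@mulgI G g)) mulVKg -{1}[k]mul1g (inj_eq (@mulIg G k)) eq_sym.
by case: eqP => [->|_]; rewrite ?scale0r// invg1 mul1g scale1r.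
Qed.

(** The image of [Psi] is a norm-closed subspace that contains the diagonal
    part of every generator. *)
Lemma diag_part_range X : D X -> (Psi @` A) (diag_part X).
Proof.
have A0 : A 0 by exact: cstar0.
have dl := @diag_part_linear R H G.
apply: (crossed_product_ind (P := fun X => (Psi @` A) (diag_part X))).
- exists 0 => //; rewrite Psi0; apply: entry_inj => g h.
  by rewrite entry_diag_part !entry0; case: ifP.
- move=> c S T [a Aa aE] [b Ab bE]; rewrite dl -aE -bE.
  by exists (c *: a + b); [exact: cstar_linear|exact: Psi_linear].
- apply: (@norm_closed_preimage _ _ _ (@diag_part R H G) _ 1) => //;
    last exact: Psi_image_closed.
  move=> S T; rewrite mul1r -[X in `|X|]addrC -scaleN1r -dl scaleN1r addrC.
  exact: norm_diag_part.
move=> g a Aa; rewrite diag_part_gen//; exists ((g == 1%g)%:R *: a).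
  exact: cstarZ.
exact: PsiZ.
Qed.

Lemma diag_part_Psi_bimodule a b X : A a -> A b ->
  diag_part (Psi a *o X *o Psi b) = Psi a *o diag_part X *o Psi b.
Proof.
move=> Aa Ab; apply: entry_inj => g h.
rewrite entry_diag_part !entry_XPsi// !entry_PsiX// entry_diag_part.
have [->|_] := eqVneq g h => //.
by rewrite ?bcomp0r ?bcomp0l.
Qed.

Lemma diag_part_Psi a : A a -> diag_part (Psi a) = Psi a.
Proof.
move=> Aa; apply: entry_inj => g h; rewrite entry_diag_part !entry_Psi// eqxx.
by [].
Qed.

Lemma diag_part_canonical : is_canonical_expectation A alpha (@diag_part R H G).
Proof.
split; last exact: diag_part_gen.
  split.
  - exact: diag_part_range.
  - by move=> _ [a Aa <-]; exact: diag_part_Psi.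
  - by move=> c X Y _ _; exact: diag_part_linear.
  - by move=> X _; exact: norm_diag_part.
  - exact: diag_part_cp.
  - by move=> _ X _ [a Aa <-] _ [b Ab <-]; exact: diag_part_Psi_bimodule.
by move=> X _; exact: diag_part_faithful.
Qed.

Lemma canonical_expectationP :
  is_canonical_expectation A alpha (canonical_expectation A alpha).
Proof.
rewrite /canonical_expectation; case: xgetP => [E _ //|h]; exfalso.
exact: (h _ diag_part_canonical).
Qed.

(** Two contractive linear maps that agree on the generators agree on the
    closure.  Outside the crossed product [E] is arbitrary, so membership is
    carried along in the induction. *)
Lemma canonical_expectation_unique E X :
  is_canonical_expectation A alpha E -> D X -> E X = diag_part X.
Proof.
move=> [Ec _ Eg] dX.
have El := cond_exp_linear Ec; have En := cond_exp_contractive Ec.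
have dl := @diag_part_linear R H G; have dn := @norm_diag_part R H G.
suff [] : D X /\ E X = diag_part X by [].
apply: (crossed_product_ind (P := fun X => D X /\ E X = diag_part X)) dX.
- split; first exact: crossed_product0.
  have := En _ crossed_product0; have := dn 0; rewrite normr0 !normr_le0.
  by move=> /eqP -> /eqP.
- move=> c S T [dS eS] [dT eT]; split; first exact: crossed_product_linear.
  by rewrite El// dl eS eT.
- move=> S h; have dS : D S.
    by apply: crossed_product_closed => e /h[T [dT _] ST]; exists T.
  split=> //; apply/eqP; rewrite -subr_eq0 -normr_le0.
  apply: (@le_of_le_eps _ _ _ 2%:R) => // e /h[T [dT eT] /ltW ST].
  rewrite add0r.
  have -> : E S - diag_part S = E (-1 *: T + S) - diag_part (-1 *: T + S).
    by rewrite El// dl eT opprD addrACA subrr add0r.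
  rewrite mulr_natl mulr2n; apply: le_trans (ler_normB _ _) _.
  have TS : `|-1 *: T + S| <= e by rewrite scaleN1r addrC.
  by apply: lerD; [apply: le_trans (En _ _) TS; exact: crossed_product_linear|
    exact: le_trans (dn _) TS].
move=> g a Aa; split; first exact: crossed_product_gen.
by rewrite Eg// diag_part_gen.
Qed.

(** For a generator X = L_g Psi(a) only one diagonal of [Y] matters:
    X * Y = L_g Psi(a) pi(L_g^* Y). *)
Lemma star_closed X Y : D X -> D Y -> D (star X Y).
Proof.
move=> dX dY; apply: (crossed_product_ind (P := fun X => D (star X Y))) dX.
- have -> : star 0 Y = 0.
    by apply: entry_inj => g h; rewrite entry_star !entry0 bcomp0l.
  exact: crossed_product0.
- by move=> c S T dS dT; rewrite star_linearl; exact: crossed_product_linear.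
- apply: (@norm_closed_preimage _ _ _ (fun X => star X Y) _ `|Y|) => //;
    last exact: crossed_product_closed.
  move=> S T.
  have -> : star S Y - star T Y = star (S - T) Y.
    have ST : S - T = -1 *: T + S by rewrite scaleN1r addrC.
    by rewrite ST star_linearl scaleN1r addrC.
  by rewrite mulrC normb_star.
move=> g a Aa.
have -> : star (Lop g *o Psi a) Y = Lop g *o (Psi a *o diag_part (Lop g^-1%g *o Y)).
  apply: entry_inj => h k; rewrite entry_star !entry_Lop entry_PsiX// entry_Psi//.
  rewrite entry_diag_part entry_Lop invgK mulVKg; case: eqP => [<-|_] //.
  by rewrite ?bcomp0r ?bcomp0l.
apply: crossed_product_Lop.
have [b Ab <-] := diag_part_range (crossed_product_Lop (g := g^-1%g) dY).
by rewrite -PsiM//; apply: crossed_product_Psi; exact: cstarM.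
Qed.

(** The set of those [X] for which the sums converge is linear, and the uniform
    bound for truncated products makes it norm closed.  For a generator
    X = L_k Psi(a) the truncation is exact as soon as [k] belongs to the finite
    set. *)
Lemma star_cvg X Y : D X ->
  (fun J : {fset G} => cut_star (fun g h => (g * h^-1)%g \in J) X Y) @ totally
  --> star X Y.
Proof.
move=> dX.
pose P X := forall e : C, 0 < e -> exists J0 : {fset G}, forall J : {fset G},
  (J0 `<=` J)%fset ->
  `|star X Y - cut_star (fun g h => (g * h^-1)%g \in J) X Y| <= e.
suff PX : P X.
  by apply/cvgrPdist_le => e /PX[J0 hJ]; exists J0.
(* The error of the truncation is linear in X and bounded uniformly in J. *)
pose K (J : {fset G}) X := star X Y - cut_star (fun g h => (g * h^-1)%g \in J) X Y.
have Kl (J : {fset G}) c S T : K J (c *: S + T) = c *: K J S + K J T.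
  rewrite /K star_linearl cut_star_linearl scalerBr opprD.
  by rewrite [LHS]addrACA.
have Kn (J : {fset G}) S : `|K J S| <= 2%:R * `|Y| * `|S|.
  apply: le_trans (ler_normB _ _) _; rewrite mulrC mulrCA mulr_natl mulr2n.
  by apply: lerD; [exact: normb_star|exact: normb_cut_star].
apply: (crossed_product_ind (P := P)) dX.
- move=> e e0; exists fset0 => J _; apply: le_trans (Kn _ _) _.
  by rewrite normr0 mulr0 ltW.
- move=> c S T PS PT e e0.
  have c1 : 0 < `|c| + 1 by rewrite ltr_wpDl.
  have e3 : 0 < e / (`|c| + 1) by rewrite divr_gt0.
  have [J1 h1] := PS _ e3; have [J2 h2] := PT _ e3.
  exists (J1 `|` J2)%fset => J; rewrite fsubUset => /andP[/h1 {}h1 /h2 {}h2].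
  rewrite -/(K _ _) Kl; apply: le_trans (ler_normD _ _) _; rewrite normrZ.
  have -> : e = `|c| * (e / (`|c| + 1)) + e / (`|c| + 1).
    by field; rewrite gt_eqF.
  apply: lerD; last exact: h2.
  by apply: ler_wpM2l; [exact: normr_ge0|exact: h1].
- move=> S h e e0.
  have Y1 : 0 < 2%:R * `|Y| + 1 by rewrite ltr_wpDl// mulr_ge0.
  have e2 : 0 < e / 2%:R by rewrite divr_gt0.
  have [T PT ST] := h _ (divr_gt0 e2 Y1); have [J0 hJ] := PT _ e2.
  exists J0 => J /hJ TJ; rewrite -/(K J S).
  have -> : K J S = K J (-1 *: T + S) + K J T.
    by rewrite Kl scaleN1r addrAC addNr add0r.
  apply: le_trans (ler_normD _ _) _.
  have -> : e = e / 2%:R + e / 2%:R by field.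
  apply: lerD; last exact: TJ.
  apply: le_trans (Kn _ _) _.
  rewrite scaleN1r addrC; apply: (@le_trans _ _ ((2%:R * `|Y| + 1) * `|S - T|)).
    by rewrite ler_wpM2r// lerDl.
  by rewrite mulrC -ler_pdivlMr// ltW.
move=> k a Aa e e0; exists [fset k]%fset => J; rewrite fsub1set => kJ.
suff -> : star (Lop k *o Psi a) Y =
    cut_star (fun g h => (g * h^-1)%g \in J) (Lop k *o Psi a) Y.
  by rewrite subrr normr0 ltW.
apply: entry_inj => g h; rewrite entry_star entry_cut_star.
rewrite entry_Lop entry_Psi//; case: eqP => [<-|_].
  by rewrite invgM invgK mulVKg kJ scale1r.
by rewrite bcomp0l scaler0.
Qed.

End crossed_product_theory.

Theorem theorem3p1 (R : realType) (H : hilbertType (Cplx R))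
    (A : set (bop H H)) (G : groupType) (alpha : G -> bop H H -> bop H H)
    (A_cstar : is_cstar_algebra A) (A_nondeg : is_nondegenerate A)
    (alpha_action : is_action A alpha) :
  let D := crossed_product A alpha in
  let pi := canonical_expectation A alpha in
  is_canonical_expectation A alpha pi
  /\ (forall X, D X -> pi X = adj Vop *o rho X *o Vop)
  /\ is_cc_assoc_product D star
  /\ (* (i) *)
     (forall X Y, D X -> D Y -> adj (star X Y) = star (adj Y) (adj X))
  /\ (* (ii) *)
     (forall X Y a, D X -> D Y -> A a ->
        star X Y *o Psi alpha a = star X (Y *o Psi alpha a)
        /\ Psi alpha a *o star X Y = star (Psi alpha a *o X) Y)
  /\ (* (iii) *)
     (forall X Y g, D X -> D Y ->
        pi (adj (Lop g) *o star X Y)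
        = pi (adj (Lop g) *o X) *o pi (adj (Lop g) *o Y))
  /\ (* (iv) *)
     (forall X Y (xi gamma : l2 G H), D X -> D Y ->
        `|inner (star X Y xi) gamma|
        <= `|op_sqrt (pi (X *o adj X)) gamma|
           * `|op_sqrt (pi (adj Y *o Y)) xi|)
  /\ (* (v) *)
     (forall X Y, D X -> D Y ->
        partial_sum (fun g : G =>
          Lop g *o pi (adj (Lop g) *o X) *o pi (adj (Lop g) *o Y)) @ totally
        --> star X Y)
  /\ (* (vi) *)
     (forall X Y, D X -> D Y -> exists S : bop (l2 G H) (l2 G H),
        `|S| <= 1
        /\ star X Y
           = op_sqrt (pi (X *o adj X)) *o S *o op_sqrt (pi (adj Y *o Y)))
  /\ (* (vii) *)
     (forall X, D X ->
        op_le (- pi (adj X *o X)) (star (adj X) X)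
        /\ op_le (star (adj X) X) (pi (adj X *o X))).
Proof.
move=> D pi.
have piE X : D X -> pi X = diag_part X.
  exact: canonical_expectation_unique (canonical_expectationP A_cstar alpha_action).
have Dmul := crossed_productM A_cstar alpha_action.
have Dadj := crossed_product_adj A_cstar alpha_action.
have DL g X : D X -> D (adj (Lop g) *o X).
  by rewrite adj_Lop; exact: crossed_product_Lop.
have Dstar := star_closed A_cstar alpha_action.
split; first exact: canonical_expectationP.
split; first exact: piE.
split.
  split=> //.
  - by move=> c X Y Z _ _ _; exact: star_linearl.
  - by move=> c X Y Z _ _ _; exact: star_linearr.
  - by move=> X Y Z _ _ _; exact: starA.
  - by move=> n X Y _ _; exact: star_completely_contractive.
split; first by move=> X Y _ _; exact: adj_star.
split.
  move=> X Y a _ _ Aa; split; apply: entry_inj => g h.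
    by rewrite (entry_XPsi A_cstar)// !entry_star (entry_XPsi A_cstar)// bcompA.
  by rewrite (entry_PsiX A_cstar)// !entry_star (entry_PsiX A_cstar)// bcompA.
split.
  move=> X Y g dX dY; rewrite !piE; try exact: DL; first exact: diag_part_Lop_star.
  by apply: DL; exact: Dstar.
split.
  move=> X Y xi gamma dX dY; rewrite !piE; try by apply: Dmul => //; exact: Dadj.
  exact: star_schwarz.
split.
  move=> X Y dX dY.
  have -> : partial_sum (fun g : G =>
      Lop g *o pi (adj (Lop g) *o X) *o pi (adj (Lop g) *o Y)) =
    (fun J : {fset G} => cut_star (fun g h => (g * h^-1)%g \in J) X Y).
    apply/funext => J; rewrite -partial_sum_cut_star; congr (partial_sum _ J).
    by apply/funext => g; rewrite !piE//; exact: DL.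
  exact: star_cvg dX.
split.
  move=> X Y dX dY; rewrite !piE; try by apply: Dmul => //; exact: Dadj.
  exact: star_factor.
move=> X dX; rewrite piE; last by apply: Dmul => //; exact: Dadj.
exact: star_adj_le.
Qed.
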